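(* Let $K_1,K_2,B_1,B_2>0$, $\Delta K := K_1-K_2<0$, $\Delta B := B_1-B_2$, and let $\Sigma^w$ be the planar conewise linear system $$\Sigma^w:\quad \dot z = A_i z,\quad z\in\mathcal S_i,\ i\in\{1,2\},\qquad A_i=\begin{bmatrix}0&1\\-K_i&-B_i\end{bmatrix},$$ $$\mathcal S_1=\{z\in\mathbb R^2 : z_2(\Delta K\, z_1+\Delta B\, z_2)\le 0\},\qquad \mathcal S_2=\{z\in\mathbb R^2 : z_2(\Delta K\, z_1+\Delta B\, z_2)> 0\}.$$ The origin of $\Sigma^w$ is globally uniformly asymptotically stable (GUAS) if at least one of the following conditions is satisfied. (i) $\Sigma^w$ has a visible eigenvector associated with an eigenvalue $\lambda<0$; in other words, one of the following two conditions is satisfied: (a) a visible eigenvector exists in $\mathcal S_1$, i.e. $\Delta B<0$, $B_1^2\ge 4K_1$ and $\dfrac{\Delta K}{\Delta B}<\dfrac{2K_1}{B_1-\sqrt{B_1^2-4K_1}}$; (b) a visible eigenvector exists in $\mathcal S_2$, i.e. $B_2^2\ge 4K_2$ and one of the following holds: 1) $\Delta B<0$ and $\dfrac{\Delta K}{\Delta B}>\dfrac{2K_2}{B_2+\sqrt{B_2^2-4K_2}}$, or 2) $\Delta B\ge 0$. (ii) $\Sigma^w$ has no visible eigenvectors and $\Lambda_1\Lambda_2<1$, where, with $L:=\sqrt{(\Delta K)^2+(\Delta B)^2}$, the numbers $\Lambda_i$, $i\in\{1,2\}$, are given by: 1) if $B_i^2<4K_i$, $$\Lambda_i=\left(\frac{K_i}{\omega_i}\left(\frac{(\Delta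 K)^2}{L^2}+\frac{Q^2}{4\omega_i^2L^2}\right)^{-1/2}\right)^{(-1)^i}e^{-\frac{B_i}{2\omega_i}\varphi_i},$$ with $\omega_i:=\frac12\sqrt{4K_i-B_i^2}$, $Q:=B_i\Delta K-2K_i\Delta B$ and $\varphi_i:=\mathrm{mod}\left(-\arctan\left(\frac{(-1)^i2\omega_i\Delta K}{Q}\right),\pi\right)$; 2) if $B_i^2=4K_i$, $$\Lambda_i=\left|\frac{B_iL}{2\Delta K-B_i\Delta B}\right|^{(-1)^i}\exp\left((-1)^i\frac{2\Delta K}{2\Delta K-B_i\Delta B}\right);$$ 3) if $B_i^2>4K_i$, $$\Lambda_i=\left|\frac{\Delta K\,\lambda_{bi}+K_i\Delta B}{K_iL}\right|^{(-1)^i\frac{\lambda_{ai}}{\lambda_{bi}-\lambda_{ai}}}\cdot\left|\frac{\Delta K\,\lambda_{ai}+K_i\Delta B}{K_iL}\right|^{(-1)^i\frac{\lambda_{bi}}{\lambda_{ai}-\lambda_{bi}}},$$ with $\lambda_{ai}:=\frac{-B_i-\sqrt{B_i^2-4K_i}}{2}$ and $\lambda_{bi}:=\frac{-B_i+\sqrt{B_i^2-4K_i}}{2}$.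
   Context: A (real) eigenvector of $A_i$ is called visible if it lies in the closure $\overline{\mathcal S}_i$ of the region $\mathcal S_i$ on which the dynamics $\dot z=A_iz$ is active. $\mathrm{mod}(\theta,\pi)\in[0,\pi)$ denotes the remainder of $\theta$ modulo $\pi$; when $Q=0$, $\arctan(\pm\infty)=\pm\pi/2$, so $\varphi_i=\pi/2$. Solutions of $\Sigma^w$ are absolutely continuous functions satisfying the differential equation for almost all times. GUAS of the origin means that it is uniformly stable and that all solutions, from any initial condition $z(t_0)=z_0\in\mathbb R^2$, converge to the origin, uniformly in $t_0$ and in $z_0$ on bounded sets; equivalently, there is a class-$\mathcal{KL}$ function $\beta$ with $\|z(t)\|\le\beta(\|z_0\|,t-t_0)$ for all $t\ge t_0$.
   Formalization: Visible eigenvector iff (a) or (b) fails for an eigenvector on the line ΔK z1+ΔB z2=0 (K1=2,B1=3,K2=6,B2=5). So (a) is shown equivalent to an eigenvector of A1 interior to S1, (b) to one of A2 in the open S2; GUAS is still proved for visibility by closure. *)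

(* Defs.v *)
From HB Require Import structures.
From mathcomp Require Import all_boot all_order all_algebra.
From mathcomp Require Import all_classical all_reals all_analysis.

Set Implicit Arguments.
Unset Strict Implicit.
Unset Printing Implicit Defensive.

Import Order.TTheory GRing.Theory Num.Theory.
Import numFieldNormedType.Exports.

Local Open Scope classical_set_scope.
Local Open Scope ring_scope.

Section Vectors.
Context {R : realType}.

(* The coordinates z_1 and z_2 of z in R^2 have indices 0 and 1. *)
Definition z1 (z : 'cV[R]_2) : R := z 0 0.
Definition z2 (z : 'cV[R]_2) : R := z 1 0.

(* The library norm on matrices is the sup norm. *)
Definition enorm (z : 'cV[R]_2) : R := Num.sqrt (z1 z ^+ 2 + z2 z ^+ 2).

(* The intervals listed in s may share endpoints but do not overlap. *)
Definition abs_continuous (a b : R) (z : R -> 'cV[R]_2) : Prop :=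
  forall eps : R, 0 < eps -> exists2 delta : R, 0 < delta &
    forall s : seq (R * R),
      all (fun p => [&& a <= p.1, p.1 <= p.2 & p.2 <= b]) s ->
      pairwise (fun p q => (p.2 <= q.1) || (q.2 <= p.1)) s ->
      \sum_(p <- s) (p.2 - p.1) < delta ->
      \sum_(p <- s) enorm (z p.2 - z p.1) < eps.

(* For 0 < p this is the remainder of x modulo p, an element of [0, p). *)
Definition rmod (x p : R) : R := x - p * (Num.floor (x / p))%:~R.

Definition eigenvector (A : 'M[R]_2) (lambda : R) (v : 'cV[R]_2) : Prop :=
  v != 0 /\ A *m v = lambda *: v.

Definition visible_eigenvector (A : 'M[R]_2) (S : set 'cV[R]_2)
    (lambda : R) (v : 'cV[R]_2) : Prop :=
  eigenvector A lambda v /\ closure S v.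

End Vectors.

Section Stability.
Context {R : realType}.

(* Only the values of beta on [0, +oo) x [0, +oo) matter. *)
Definition class_KL (beta : R -> R -> R) : Prop :=
  [/\ {within [set p : R * R | 0 <= p.1 /\ 0 <= p.2],
        continuous (fun p : R * R => beta p.1 p.2)},
      (forall s : R, 0 <= s -> beta 0 s = 0),
      (forall s r r' : R, 0 <= s -> 0 <= r -> r < r' -> beta r s < beta r' s),
      (forall r s s' : R, 0 <= r -> 0 <= s -> s <= s' -> beta r s' <= beta r s) &
      (forall r : R, 0 <= r -> beta r s @[s --> +oo] --> (0 : R))].

(* In this section, sol t0 z says that z is a solution on [t0, +oo). *)
Definition GUAS (sol : R -> (R -> 'cV[R]_2) -> Prop) : Prop :=
  exists2 beta : R -> R -> R, class_KL beta &
    forall t0 z, sol t0 z -> forall t, t0 <= t ->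
      enorm (z t) <= beta (enorm (z t0)) (t - t0).

Definition uniformly_stable (sol : R -> (R -> 'cV[R]_2) -> Prop) : Prop :=
  forall eps : R, 0 < eps -> exists2 delta : R, 0 < delta &
    forall t0 z, sol t0 z -> enorm (z t0) < delta ->
      forall t, t0 <= t -> enorm (z t) < eps.

Definition globally_uniformly_attractive
    (sol : R -> (R -> 'cV[R]_2) -> Prop) : Prop :=
  forall r eps : R, 0 < eps -> exists2 T : R, 0 <= T &
    forall t0 z, sol t0 z -> enorm (z t0) <= r ->
      forall t, t0 + T <= t -> enorm (z t) < eps.

Lemma GUAS_stable_attractive (sol : R -> (R -> 'cV[R]_2) -> Prop) :
  GUAS sol -> uniformly_stable sol /\ globally_uniformly_attractive sol.
Proof.
move=> [b [bc b0 bi bd bl] H]; split.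
- move=> e e0.
  have /subspace_continuousP /(_ (0, 0)) bc0 := bc.
  have := bc0 (conj (lexx 0) (lexx 0)).
  move=> /cvgrPdist_lt /(_ e e0); rewrite /from_subspace /= b0 //.
  rewrite near_withinE => /nbhs_ballP [d /= d0 Hd].
  exists d => // t0 z sz zd t tt.
  have n0 : 0 <= enorm (z t0) by exact: sqrtr_ge0.
  have : `|0 - b (enorm (z t0)) 0| < e.
    apply: (Hd (enorm (z t0), 0)) => //=.
    split => /=; last exact: ballxx.
    by rewrite /ball /= sub0r normrN ger0_norm.
  rewrite sub0r normrN => /(le_lt_trans (ler_norm _)); apply: le_lt_trans.
  by apply: (le_trans (H _ _ sz _ tt)); apply: bd => //; rewrite subr_ge0.
- move=> r e e0.
  have m0 : 0 <= Num.max r 0 by rewrite le_max lexx orbT.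
  have := bl _ m0 => /cvgrPdist_lt /(_ e e0) [T [_ HT]].
  have T0 : 0 <= Num.max T 0 + 1.
    by rewrite addr_ge0 // le_max lexx orbT.
  exists (Num.max T 0 + 1) => // t0 z sz zr t tt.
  have st : Num.max T 0 + 1 <= t - t0 by rewrite lerBrDl.
  have s0 : 0 <= t - t0 by exact: le_trans st.
  have n0 : 0 <= enorm (z t0) by exact: sqrtr_ge0.
  have Ts : T < t - t0.
    apply: lt_le_trans st; apply: (@le_lt_trans _ _ (Num.max T 0)).
      by rewrite le_max lexx.
    by rewrite ltrDl.
  have := HT _ Ts; rewrite sub0r normrN => /(le_lt_trans (ler_norm _)).
  apply: le_lt_trans; apply: (le_trans (H _ _ sz t _)).
    by rewrite -subr_ge0.
  have : enorm (z t0) <= Num.max r 0 by rewrite le_max zr.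
  rewrite le_eqVlt => /orP[/eqP -> //|lt]; exact/ltW/bi.
Qed.

End Stability.

Section System.
Context {R : realType}.

Definition Amx (K B : R) : 'M[R]_2 :=
  \matrix_(i, j) nth 0 (nth [::] [:: [:: 0; 1]; [:: - K; - B]] i) j.

Definition S1 (K1 K2 B1 B2 : R) : set 'cV[R]_2 :=
  [set z | z2 z * ((K1 - K2) * z1 z + (B1 - B2) * z2 z) <= 0].

Definition S2 (K1 K2 B1 B2 : R) : set 'cV[R]_2 :=
  [set z | z2 z * ((K1 - K2) * z1 z + (B1 - B2) * z2 z) > 0].

(* z is a solution of the switched system on [t0, +oo) in Caratheodory's sense. *)
Definition Sigma_w (K1 K2 B1 B2 t0 : R) (z : R -> 'cV[R]_2) : Prop :=
  (forall t1, t0 <= t1 -> abs_continuous t0 t1 z) /\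
  {ae (@lebesgue_measure R), forall t, t0 <= t ->
    (S1 K1 K2 B1 B2 (z t) -> is_derive t 1 z (Amx K1 B1 *m z t)) /\
    (S2 K1 K2 B1 B2 (z t) -> is_derive t 1 z (Amx K2 B2 *m z t))}.

Definition visible (K1 K2 B1 B2 lambda : R) (v : 'cV[R]_2) : Prop :=
  visible_eigenvector (Amx K1 B1) (S1 K1 K2 B1 B2) lambda v \/
  visible_eigenvector (Amx K2 B2) (S2 K1 K2 B1 B2) lambda v.

Definition condition_a (K1 K2 B1 B2 : R) : Prop :=
  [/\ B1 - B2 < 0, 4 * K1 <= B1 ^+ 2 &
      (K1 - K2) / (B1 - B2) < 2 * K1 / (B1 - Num.sqrt (B1 ^+ 2 - 4 * K1))].

Definition condition_b (K1 K2 B1 B2 : R) : Prop :=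
  4 * K2 <= B2 ^+ 2 /\
  ((B1 - B2 < 0 /\
    2 * K2 / (B2 + Num.sqrt (B2 ^+ 2 - 4 * K2)) < (K1 - K2) / (B1 - B2)) \/
   0 <= B1 - B2).

Section Lambda.
Variables (i : nat) (K B dK dB : R).

Let sgn : R := (-1) ^+ i.
Let L : R := Num.sqrt (dK ^+ 2 + dB ^+ 2).

Definition omega : R := 2^-1 * Num.sqrt (4 * K - B ^+ 2).

Definition Qc : R := B * dK - 2 * K * dB.

(* The first branch is the limit value given by arctan (+oo) = pi / 2 and
   arctan (-oo) = - pi / 2, whereas division by 0 gives 0 in the library. *)
Definition phi : R :=
  if Qc == 0 then pi / 2
  else rmod (- atan (sgn * 2 * omega * dK / Qc)) pi.

Definition lambda_a : R := (- B - Num.sqrt (B ^+ 2 - 4 * K)) / 2.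

Definition lambda_b : R := (- B + Num.sqrt (B ^+ 2 - 4 * K)) / 2.

(* Real powers are needed in the last case only, but are used throughout. *)
Definition Lambda : R :=
  if B ^+ 2 < 4 * K then
    (K / omega *
      (dK ^+ 2 / L ^+ 2 + Qc ^+ 2 / (4 * omega ^+ 2 * L ^+ 2)) `^ (- 2^-1))
      `^ sgn * expR (- (B / (2 * omega)) * phi)
  else if B ^+ 2 == 4 * K then
    `|B * L / (2 * dK - B * dB)| `^ sgn *
      expR (sgn * (2 * dK / (2 * dK - B * dB)))
  else
    `|(dK * lambda_b + K * dB) / (K * L)|
        `^ (sgn * (lambda_a / (lambda_b - lambda_a))) *
    `|(dK * lambda_a + K * dB) / (K * L)|
        `^ (sgn * (lambda_b / (lambda_a - lambda_b))).

End Lambda.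

End System.

(* Main.v *)
(* Write [P_i z = z2^2 + B_i z1 z2 + K_i z1^2], so that [P_i' = - B_i P_i] along
   [A_i], while the angular speed is [- P_i / |z|^2].  Since [z2 * z2'] is always
   the largest of its two possible values, trajectories turn clockwise until they
   are stopped by an invariant ray, if there is one.

   A visible eigenvector spans a line [z2 = - mu z1] that no trajectory crosses.
   On each of its two sides a trajectory visits at most three quadrants, always in
   the same order, and a quadratic form on each of them decreases exponentially;
   the forms glue along the half-axes.

   Without visible eigenvectors, [P_i > 0] on the closure of [S_i], where a function
   [tau_i], homogeneous of degree 0 with gradient [(z2, - z1) / P_i], measures the
   time spent in [S_i].  The form [P_i exp ((B_i - kappa) tau_i)] then decays exactly
   at rate [kappa].  With [T_i] the time needed to cross [S_i], one finds
   [Lambda_1 * Lambda_2 = sqrt (K2 / K1) * exp (- (B1 T1 + B2 T2) / 2)], and the two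
   forms can be glued for a positive [kappa] exactly when this product is less
   than 1. *)
Require Import Defs.
From HB Require Import structures.
From mathcomp Require Import all_boot all_order all_algebra.
From mathcomp Require Import all_classical all_reals all_analysis.
From mathcomp Require Import ring lra.

Import Order.TTheory GRing.Theory Num.Theory.
Import numFieldNormedType.Exports.

Set Implicit Arguments.
Unset Strict Implicit.
Unset Printing Implicit Defensive.

Local Open Scope classical_set_scope.
Local Open Scope ring_scope.


(** * Absolutely continuous functions with a one-sided derivative bound *)

(** The field is discontinuous on the axis [z2 = 0], solutions are differentiable only almost
    everywhere, and the glued Lyapunov functions have no gradient on the lines where two pieces
    meet. Following a trajectory from one switching to the next would require excluding an
    accumulation of switchings; instead, all estimates are local in time. Near a point [p], the
    increment of a glued function is compared with the gradient of some piece whose closed domain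
    contains [p], so decay is checked for every such piece against the one value of the field at
    [p]. Absolute continuity then turns the local bounds into an inequality between end points,
    without any integral. On the switching line the two matrices give the same velocity, so gluing
    there costs nothing. On the axis they differ and [A_1] is the active one, which lowers the decay
    rate in the rotating case. Since all pieces are homogeneous of degree two, the outcome is an
    exponential bound, a particular class KL function. *)

(** The single step hypothesis contains both halves of the usual induction: with [t = c] it reaches
    the supremum from its left, with [s = c] it goes beyond it. *)
Lemma real_induction (R : realType) (a b : R) (P : R -> Prop) :
  a <= b -> P a ->
  (forall c, a <= c <= b -> exists2 d : R, 0 < d & forall s t,
     a <= s -> s <= c -> c <= t -> t <= b -> c - s < d -> t - c < d ->
     P s -> P t) ->
  P b.
Proof.
move=> ab Pa step.
pose E := [set t : R | a <= t <= b /\ P t].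
have Ea : E a by split => //; rewrite lexx ab.
have ubE : ubound E b by move=> t [/andP[]].
have supE : has_sup E by split; [exists a | exists b].
have ac : a <= sup E by apply: ub_le_sup => //; exists b.
have cb : sup E <= b by apply: ge_sup => //; exists a.
have [|d d0 Hd] := step (sup E); first by rewrite ac cb.
have [s [/andP[as_ sb] Ps] sc] := sup_adherent d0 supE.
have sle : s <= sup E by apply: ub_le_sup => //; [exists b | split => //; apply/andP].
have Pt t : sup E <= t -> t <= b -> t - sup E < d -> P t.
  by move=> ct tb tc; apply: (Hd s t) => //; lra.
have [bc|bc] := leP b (sup E).
  by apply: Pt => //; lra.
pose t := Num.min b (sup E + d / 2).
have tb : t <= b by rewrite ge_min lexx.
have td : t <= sup E + d / 2 by rewrite ge_min lexx orbT.
have ct : sup E < t by rewrite lt_min bc /=; lra.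
have : t <= sup E.
  apply: ub_le_sup; [by exists b|split].
    by rewrite tb andbT; lra.
  by apply: Pt => //; lra.
by rewrite leNgt ct.
Qed.

Lemma enorm_ge0 (R : realType) (v : 'cV[R]_2) : 0 <= enorm v.
Proof. exact: sqrtr_ge0. Qed.

Lemma enormN (R : realType) (v : 'cV[R]_2) : enorm (- v) = enorm v.
Proof. by rewrite /enorm /z1 /z2 !mxE !sqrrN. Qed.

Lemma enormC (R : realType) (u v : 'cV[R]_2) : enorm (u - v) = enorm (v - u).
Proof. by rewrite -opprB enormN. Qed.

Lemma negligible_open_cover (R : realType) (N : set R) (d : R) :
  (@lebesgue_measure R).-negligible N -> 0 < d ->
  exists U : set R, [/\ open U, N `<=` U & (lebesgue_measure U < d%:E)%E].
Proof.
move=> [A [mA A0 NA]] d0.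
have Aoo : (lebesgue_measure A < +oo)%E by rewrite A0.
have [U [oU AU UA]] := lebesgue_regularity_outer mA Aoo d0.
exists U; split => //; first exact: subset_trans AU.
have mU : measurable U by exact: measurable_realfun.open_measurable.
have -> : U = (U `\` A) `|` A by rewrite setUC setDUK.
rewrite measureU //; [|exact: measurableD|by apply/seteqP; split => x // [[]]].
by rewrite [X in (_ + X)%E]A0 adde0.
Qed.

(** Away from [N] the function grows with slope at most [e]. The set [N] is covered by an open set
    of small measure, where the Lipschitz bound in [z] and absolute continuity make the total
    increment small. The term [|s - c|] in the Lipschitz bound leaves room for an explicit
    dependence on time, such as an exponential weight. *)
Lemma ac_nonincreasing (R : realType) (a b C : R) (phi : R -> R)
    (z : R -> 'cV[R]_2) (N : set R) :
  a <= b -> 0 <= C -> abs_continuous a b z ->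
  (@lebesgue_measure R).-negligible N ->
  (forall c, a <= c <= b -> exists2 d : R, 0 < d & forall s, a <= s <= b ->
     `|s - c| < d -> `|phi s - phi c| <= C * (enorm (z s - z c) + `|s - c|)) ->
  (forall c, a <= c <= b -> ~ N c -> forall e : R, 0 < e ->
     exists2 d : R, 0 < d & forall s, a <= s <= b -> `|s - c| < d ->
       (c <= s -> phi s - phi c <= e * (s - c)) /\
       (s <= c -> phi c - phi s <= e * (c - s))) ->
  phi b <= phi a.
Proof.
move=> ab C0 acz N0 Hlip Hder.
suff H (e : R) : 0 < e -> phi b - phi a <= e * (b - a + C + C).
  rewrite -subr_le0 leNgt; apply/negP => pos.
  have K0 : 0 < b - a + C + C + 1 by lra.
  have := H ((phi b - phi a) / (b - a + C + C + 1) / 2).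
  rewrite !divr_gt0 // => /(_ isT).
  set D := phi b - phi a in pos *; set K := b - a + C + C + 1 in K0 *.
  rewrite (_ : b - a + C + C = K - 1); last by rewrite /K; ring.
  rewrite (_ : D / K / 2 * (K - 1) = D / 2 - D / K / 2); last by field; rewrite gt_eqF.
  have := divr_gt0 pos K0; lra.
move=> e0.
have [d1 d10 Hac] := acz e e0.
(* [d1] controls the variation of [z] over the exceptional intervals, [e] their total length; both
   occur in the Lipschitz bound. *)
pose d := Num.min d1 e.
have d0 : 0 < d by rewrite lt_min d10.
have [U [oU NU mUd]] := negligible_open_cover N0 d0.
have mU : measurable U by exact: measurable_realfun.open_measurable.
pose mu := @lebesgue_measure R.
(* Up to time [t], the increment of [phi] is at most [e * (t - a)], except on finitely
   many intervals contained in [U], where absolute continuity makes it small. *)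
pose dist (p : R * R) := enorm (z p.2 - z p.1) + (p.2 - p.1).
pose P t := exists s : seq (R * R), [/\
  all (fun p => [&& a <= p.1, p.1 <= p.2 & p.2 <= t]) s,
  pairwise (fun p q => (p.2 <= q.1) || (q.2 <= p.1)) s,
  ((\sum_(p <- s) (p.2 - p.1))%:E <= mu (U `&` `]a, t]%classic))%E &
  phi t - phi a <= e * (t - a) + C * \sum_(p <- s) dist p].
have mI t : measurable (U `&` `]a, t]%classic) by exact: measurableI.
have good s t : s <= t -> phi t - phi s <= e * (t - s) -> P s -> P t.
  move=> st h [l [l1 l2 l3 l4]].
  have sub : U `&` `]a, s]%classic `<=` U `&` `]a, t]%classic.
    by move=> x [Ux] /=; rewrite !in_itv /= => /andP[ax xs]; rewrite ax (le_trans xs).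
  exists l; split => //.
  - apply: sub_all l1 => p /and3P[-> -> /=] h1; exact: le_trans st.
  - apply: (le_trans l3); apply: le_measure; [apply: mem_set; exact: mI|apply: mem_set; exact: mI|].
    exact: sub.
  - lra.
have bad s t : a <= s -> s <= t -> `]s, t]%classic `<=` U ->
    phi t - phi s <= C * dist (s, t) -> P s -> P t.
  move=> as_ st h h' [l [l1 l2 l3 l4]]; exists ((s, t) :: l); split => /=.
  - rewrite as_ st lexx /=.
    apply: sub_all l1 => p /and3P[-> -> /=] h1; exact: le_trans st.
  - rewrite l2 andbT; apply: sub_all l1 => p /and3P[_ _ ->].
    by rewrite orbT.
  - rewrite big_cons /= addrC EFinD.
    have -> : U `&` `]a, t]%classic = (U `&` `]a, s]%classic) `|` `]s, t]%classic.
      apply/seteqP; split => x /=; rewrite !in_itv /=.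
        move=> [Ux /andP[ax xt]]; have [xs|sx] := leP x s.
          by left; rewrite ax.
        by right; rewrite xt.
      move=> [[Ux /andP[ax xs]]|/andP[sx xt]].
        by split => //; rewrite ax (le_trans xs).
      by split; [apply: h; rewrite /= in_itv /= sx | rewrite (le_lt_trans as_)].
    have -> : mu ((U `&` `]a, s]) `|` `]s, t]) =
        (mu (U `&` `]a, s]) + mu `]s, t]%classic)%E.
      rewrite /mu measureU //; first exact: mI.
      apply/seteqP; split => x //= [[_]]; rewrite !in_itv /= => /andP[_ xs] /andP[].
      by rewrite ltNge xs.
    apply: leeD => //; rewrite /mu lebesgue_measure_itv /= lte_fin.
    case: ltP => [_|ts]; first by rewrite -EFinB.
    by rewrite lee_fin; lra.
  - have := ler_wpM2l (ltW e0) st; rewrite big_cons mulrDr; lra.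
have : P b.
  apply: (@real_induction R a b P) => //.
    by exists [::]; split; rewrite ?big_nil ?measure_ge0 //; lra.
  move=> c acb.
  have [d2 d20 H2] := Hlip c acb.
  have [Nc|Nc] := pselect (N c); last first.
    have [d3 d30 H3] := Hder c acb Nc e e0.
    exists d3 => // s t as_ sc ct tb h1 h2 Ps.
    have /andP[ac cb] := acb.
    have Pc : P c.
      apply: (good s) => //; apply: (proj2 (H3 s _ _)) => //.
        by rewrite as_ (le_trans sc).
      by rewrite distrC ger0_norm ?subr_ge0.
    apply: (good c) => //; apply: (proj1 (H3 t _ _)) => //.
      by rewrite tb (le_trans ac).
    by rewrite ger0_norm ?subr_ge0.
  have /(open_subball oU)[d3 /= d30 Hb] := NU _ Nc.
  exists (Num.min d2 (d3 / 2)); first by rewrite lt_min d20 divr_gt0.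
  move=> s t as_ sc ct tb; rewrite !lt_min => /andP[h1 h1'] /andP[h2 h2'] Ps.
  have /andP[ac cb] := acb.
  have inU x : s < x -> x <= t -> U x.
    move=> sx xt; apply: (Hb (d3 / 2) _ _ x).
    - by rewrite /ball_ /= sub0r normrN ger0_norm; lra.
    - lra.
    - by rewrite /ball /= ltr_norml; apply/andP; split; lra.
  have Pc : P c.
    apply: (bad s) => //.
      by move=> x /=; rewrite in_itv /= => /andP[sx xc]; apply: inU => //; lra.
    have := H2 s; rewrite as_ (le_trans sc cb) distrC ger0_norm ?subr_ge0 //.
    move=> /(_ isT h1); rewrite /dist /= enormC distrC => h.
    exact: le_trans (ler_norm _) h.
  apply: (bad c) => //.
    by move=> x /=; rewrite in_itv /= => /andP[cx xt]; apply: inU => //; lra.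
  have := H2 t; rewrite tb (le_trans ac ct) [`|t - c|]ger0_norm ?subr_ge0 //.
  move=> /(_ isT h2) h; exact: le_trans (ler_norm _) h.
move=> [s [s1 s2 s3 s4]].
have ls : \sum_(p <- s) (p.2 - p.1) < d.
  rewrite -lte_fin; apply: (le_lt_trans s3); apply: le_lt_trans mUd.
  by by apply: le_measure; [apply: mem_set; exact: mI|apply: mem_set; exact: mU|move=> x []].
have := Hac s s1 s2; rewrite (lt_le_trans ls) ?ge_min ?lexx // => /(_ isT) h1.
have {}ls : \sum_(p <- s) (p.2 - p.1) < e.
  by rewrite (lt_le_trans ls) ?ge_min ?lexx ?orbT.
apply: (le_trans s4).
rewrite big_split /= [leRHS](_ : _ = e * (b - a) + C * (e + e)); last by ring.
by rewrite lerD2l ler_wpM2l // lerD // ltW.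
Qed.

Lemma is_derive_eps (R : realType) (f : R -> R) (c df : R) :
  is_derive c 1 f df -> forall e : R, 0 < e -> exists2 d : R, 0 < d &
    forall s, `|s - c| < d -> `|f s - f c - df * (s - c)| <= e * `|s - c|.
Proof.
move=> [cf <-] e e0.
have := cf; rewrite /derivable => /cvgrPdist_le /(_ e e0) [d /= d0 Hd].
exists d => // s sc.
have [->|snc] := eqVneq s c; first by rewrite !subrr mulr0 subrr normr0 mulr0.
have h0 : s - c != 0 by rewrite subr_eq0.
have := Hd (s - c); rewrite /ball_ /= sub0r normrN => /(_ sc h0).
rewrite [_%:A]mulr1 subrK /derive => h.
rewrite -ler_pdivrMr ?normr_gt0 // -normrV ?unitfE // -normrM.
rewrite mulrBl mulfK // -normrN opprB [_ / _]mulrC.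
exact: h.
Qed.

(** This is the increment of [expR (k * s) * phi s] between [c] and [s]: [A] and [B] are the
    increments of the factors, and [p] is [phi c]. The main terms [- k * p * Es * h] and
    [k * p * Ec * h] cancel up to [Es - Ec]. With [h] the length of the step, one statement serves
    both sides of [c]. *)
Lemma gronwall_step (R : realType) (k M E e eta A B h Ec Es p : R) :
  0 <= h -> 0 <= M -> `|p| <= M -> 0 < Es -> Es <= E -> 0 <= e -> 0 <= eta ->
  A <= (- k * p + e) * h -> `|B - k * Ec * h| <= eta * h -> `|Es - Ec| <= eta ->
  Es * A + p * B <= (`|k| * M * eta + E * e + M * eta) * h.
Proof.
move=> h0 M0 pM Es0 EsE e0 eta0 hA hB hE.
have h1 : Es * A <= Es * ((- k * p + e) * h) by rewrite ler_pM2l.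
have h2 : p * (B - k * Ec * h) <= M * (eta * h).
  by apply: (le_trans (ler_norm _)); rewrite normrM ler_pM.
have h3 : - k * p * (Es - Ec) * h <= `|k| * M * eta * h.
  apply: ler_wpM2r => //; apply: (le_trans (ler_norm _)).
  by rewrite !normrM normrN ler_pM // ?mulr_ge0 // ler_wpM2l.
have h4 : Es * e * h <= E * e * h by rewrite ler_wpM2r // ler_wpM2r.
have -> : Es * A + p * B =
  Es * A - Es * ((- k * p + e) * h) + p * (B - k * Ec * h) +
  - k * p * (Es - Ec) * h + Es * e * h by ring.
have -> : (`|k| * M * eta + E * e + M * eta) * h =
  `|k| * M * eta * h + E * e * h + M * (eta * h) by ring.
lra.
Qed.

Lemma ac_gronwall (R : realType) (a b C k M : R) (phi : R -> R)
    (z : R -> 'cV[R]_2) (N : set R) :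
  a <= b -> 0 <= C -> abs_continuous a b z ->
  (@lebesgue_measure R).-negligible N ->
  (forall c, a <= c <= b -> `|phi c| <= M) ->
  (forall c, a <= c <= b -> exists2 d : R, 0 < d & forall s, a <= s <= b ->
     `|s - c| < d -> `|phi s - phi c| <= C * enorm (z s - z c)) ->
  (forall c, a <= c <= b -> ~ N c -> forall e : R, 0 < e ->
     exists2 d : R, 0 < d & forall s, a <= s <= b -> `|s - c| < d ->
       (c <= s -> phi s - phi c <= (- k * phi c + e) * (s - c)) /\
       (s <= c -> phi c - phi s <= (- k * phi c + e) * (c - s))) ->
  phi b <= expR (- k * (b - a)) * phi a.
Proof.
move=> ab C0 acz N0 HM Hlip Hder.
have M0 : 0 <= M by apply: le_trans (HM a _); rewrite ?lexx.
pose E := expR (`|k| * (`|a| + `|b|)).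
have E0 : 0 < E by exact: expR_gt0.
have EE s : a <= s <= b -> expR (k * s) <= E.
  move=> /andP[as_ sb]; rewrite /E ler_expR.
  apply: (le_trans (ler_norm _)); rewrite normrM ler_wpM2l // ler_norml.
  have := ler_norm a; have := ler_norm b; have := ler_norm (- a).
  have := ler_norm (- b); rewrite !normrN; lra.
have De (c : R) : is_derive c 1 (fun s : R => expR (k * s)) (k * expR (k * c)).
  have H : is_derive c 1 (fun s : R => k * s) k.
    by apply: is_derive_eq; rewrite /= [k *: _]mulr1.
  have := @is_derive1_comp R expR (fun s : R => k * s) c _ _ (is_derive_expR _) H.
  by rewrite mulrC.
have Ce (c e : R) : 0 < e -> exists2 d : R, 0 < d & forall s,
    `|s - c| < d -> `|expR (k * s) - expR (k * c)| <= e.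
  move=> e0; have [d d0 Hd] := is_derive_eps (De c) ltr01.
  pose A := 1 + `|k * expR (k * c)|.
  have A0 : 0 < A by rewrite /A; have := normr_ge0 (k * expR (k * c)); lra.
  exists (Num.min d (e / A)); first by rewrite lt_min d0 divr_gt0.
  move=> s; rewrite lt_min => /andP[sd]; rewrite ltr_pdivlMr // => sA.
  have := Hd s sd; rewrite mul1r => h.
  rewrite -[X in `|X|](subrK (k * expR (k * c) * (s - c))).
  apply: (le_trans (ler_normD _ _)); rewrite [`|_ * (s - c)|]normrM.
  by move: sA; rewrite /A mulrDr mulr1 [_ * `|k * _|]mulrC => sA; lra.
pose psi s := expR (k * s) * phi s.
suff : psi b <= psi a.
  rewrite /psi => h; rewrite mulrBr expRD mulNr expRN mulNr opprK mulrAC -mulrA.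
  by rewrite mulrC ler_pdivlMr ?expR_gt0 // mulrC [phi a * _]mulrC.
have split_ s c : psi s - psi c = expR (k * s) * (phi s - phi c) +
    phi c * (expR (k * s) - expR (k * c)) by rewrite /psi; ring.
apply: (@ac_nonincreasing R a b (E * C + M * (`|k| * E + 1)) psi z N) => //.
- by rewrite !addr_ge0 ?mulr_ge0 ?addr_ge0 ?mulr_ge0 // ltW.
- move=> c cab; have [d1 d10 H1] := Hlip c cab.
  have [d2 d20 H2] := is_derive_eps (De c) ltr01.
  exists (Num.min d1 d2); first by rewrite lt_min d10.
  move=> s sab; rewrite lt_min => /andP[s1 s2].
  have {}H1 := H1 s sab s1; have {}H2 := H2 s s2; rewrite mul1r in H2.
  have n0 := enorm_ge0 (z s - z c).
  have hE : `|expR (k * s) - expR (k * c)| <= (`|k| * E + 1) * `|s - c|.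
    rewrite -[X in `|X|](subrK (k * expR (k * c) * (s - c))).
    apply: (le_trans (ler_normD _ _)); rewrite [`|_ * (s - c)|]normrM.
    rewrite mulrDl mul1r addrC lerD // ler_wpM2r // normrM ler_wpM2l //.
    by rewrite ger0_norm ?expR_ge0 // EE.
  rewrite split_; apply: (le_trans (ler_normD _ _)); rewrite !normrM.
  rewrite (ger0_norm (expR_ge0 _)).
  have h1 : expR (k * s) * `|phi s - phi c| <= E * (C * enorm (z s - z c)).
    by rewrite ler_pM ?expR_ge0 ?EE.
  have h2 : `|phi c| * `|expR (k * s) - expR (k * c)| <=
      M * ((`|k| * E + 1) * `|s - c|) by apply: ler_pM => //; exact: HM.
  apply: (le_trans (lerD h1 h2)).
  rewrite mulrDl mulrDr mulrDr !mulrA.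
  have : 0 <= E * C * `|s - c| by rewrite !mulr_ge0 // ltW.
  have : 0 <= M * (`|k| * E + 1) * enorm (z s - z c).
    by rewrite !mulr_ge0 // addr_ge0 // mulr_ge0 // ltW.
  lra.
- move=> c cab Nc e e0.
  (* With this [eta], the terms in [eta] of [gronwall_step] cost at most [e / 2]; the slack
     [e / (2 * E)] in the bound on [phi] costs the other half. *)
  pose eta := e / (2 * (`|k| * M + M + 1)).
  have Z0 : 0 < `|k| * M + M + 1.
    by have := mulr_ge0 (normr_ge0 k) M0; lra.
  have eta0 : 0 < eta by rewrite divr_gt0 // mulr_gt0.
  have e'0 : 0 < e / (2 * E) by rewrite divr_gt0 // mulr_gt0.
  have [d1 d10 H1] := Hder c cab Nc _ e'0.
  have [d2 d20 H2] := is_derive_eps (De c) eta0.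
  have [d3 d30 H3] := Ce c _ eta0.
  have fin : `|k| * M * eta + E * (e / (2 * E)) + M * eta <= e.
    have -> : E * (e / (2 * E)) = e / 2 by field; rewrite gt_eqF.
    have : (`|k| * M + M + 1) * eta = e / 2.
      by rewrite /eta; field; rewrite gt_eqF.
    lra.
  exists (Num.min d1 (Num.min d2 d3)); first by rewrite !lt_min d10 d20.
  move=> s sab; rewrite !lt_min => /and3P[s1 s2 s3].
  have [G1 G2] := H1 s sab s1; have {}H2 := H2 s s2; have {}H3 := H3 s s3.
  split => sc.
    rewrite split_; have h0 : 0 <= s - c by rewrite subr_ge0.
    apply: (@le_trans _ _ ((`|k| * M * eta + E * (e / (2 * E)) + M * eta) * (s - c))).
      apply: (@gronwall_step _ k M E _ _ _ _ _ (expR (k * c))) => //; try exact: ltW.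
      - exact: HM.
      - exact: expR_gt0.
      - exact: EE.
      - exact: G1.
      - by rewrite -{2}(ger0_norm h0).
    exact: ler_wpM2r.
  have h0 : 0 <= c - s by rewrite subr_ge0.
  rewrite (_ : psi c - psi s = expR (k * s) * (phi c - phi s) +
    phi c * (expR (k * c) - expR (k * s))); last by rewrite /psi; ring.
  apply: (@le_trans _ _ ((`|k| * M * eta + E * (e / (2 * E)) + M * eta) * (c - s))).
    apply: (@gronwall_step _ k M E _ _ _ _ _ (expR (k * c))) => //; try exact: ltW.
    - exact: HM.
    - exact: expR_gt0.
    - exact: EE.
    - exact: G2.
    - move: H2; rewrite -normrN [X in eta * X]distrC (ger0_norm h0); congr (_ <= _).
      by congr (`| _ |); ring.
  exact: ler_wpM2r.
Qed.

(** * Piecewise differentiable Lyapunov functions *)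

(* Caratheodory's form of the chain rule needs no remainder estimates: the
   increment of [f] at [p] is a combination of the increments of the coordinates
   whose coefficients tend to the components of [g] at [p]. *)
Definition has_grad (R : realType) (f : R * R -> R) (p g : R * R) : Prop :=
  exists s1 s2 : R * R -> R, [/\ s1 q @[q --> p] --> g.1, s2 q @[q --> p] --> g.2 &
    forall q, f q - f p = s1 q * (q.1 - p.1) + s2 q * (q.2 - p.2)].

Section has_grad.
Context {R : realType}.
Implicit Types (f : R * R -> R) (p g : R * R).

Lemma has_grad_cvg f p g : has_grad f p g -> f q @[q --> p] --> f p.
Proof.
move=> [s1 [s2 [c1 c2 E]]].
have F : f = (fun q => f p + (s1 q * (q.1 - p.1) + s2 q * (q.2 - p.2))).
  by apply/funext => q; rewrite -E addrC subrK.
rewrite {1}F -[X in _ --> X]addr0; apply: cvgD; first exact: cvg_cst.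
rewrite -[X in _ --> X]addr0; apply: cvgD.
  rewrite -[X in _ --> X](mulr0 g.1); apply: cvgM => //.
  by rewrite -(subrr p.1); apply: cvgB; [exact: cvg_fst|exact: cvg_cst].
rewrite -[X in _ --> X](mulr0 g.2); apply: cvgM => //.
by rewrite -(subrr p.2); apply: cvgB; [exact: cvg_snd|exact: cvg_cst].
Qed.

Lemma has_grad_eq f f' p g g' :
  has_grad f p g -> f =1 f' -> g.1 = g'.1 -> g.2 = g'.2 -> has_grad f' p g'.
Proof.
move=> [s1 [s2 [c1 c2 E]]] ff' g1 g2; exists s1, s2; split.
- by rewrite -g1.
- by rewrite -g2.
- by move=> q; rewrite -!ff'.
Qed.

Lemma has_grad_linear (a b : R) p :
  has_grad (fun q => a * q.1 + b * q.2) p (a, b).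
Proof.
exists (cst a), (cst b); split; [exact: cvg_cst|exact: cvg_cst|].
by move=> q /=; ring.
Qed.

Lemma has_gradM f f' p g g' : has_grad f p g -> has_grad f' p g' ->
  has_grad (fun q => f q * f' q) p
    (g.1 * f' p + f p * g'.1, g.2 * f' p + f p * g'.2).
Proof.
move=> hf hf'; have cf' := has_grad_cvg hf'.
move: hf hf' => [s1 [s2 [c1 c2 E]]] [t1 [t2 [d1 d2 E']]].
exists (fun q => s1 q * f' q + f p * t1 q), (fun q => s2 q * f' q + f p * t2 q).
split => /=.
- by apply: cvgD; apply: cvgM => //; exact: cvg_cst.
- by apply: cvgD; apply: cvgM => //; exact: cvg_cst.
- move=> q; rewrite (_ : f q * f' q - f p * f' p =
    (f q - f p) * f' q + f p * (f' q - f' p)); last by ring.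
  by rewrite E E'; ring.
Qed.

Lemma has_grad_comp (h : R -> R) f p g (dh : R) : has_grad f p g ->
  is_derive (f p) 1 h dh ->
  has_grad (fun q => h (f q)) p (dh * g.1, dh * g.2).
Proof.
move=> hf Dh; have cf := has_grad_cvg hf.
move: hf => [s1 [s2 [c1 c2 E]]].
(* The slope of [h] from [f p], completed by [dh] at [f p]: it is continuous there and [HE] holds
   for every [y]. *)
pose H y := if y == f p then dh else (h y - h (f p)) / (y - f p).
have HE y : h y - h (f p) = H y * (y - f p).
  rewrite /H; case: eqVneq => [->|yp]; first by rewrite !subrr mulr0.
  by rewrite divfK // subr_eq0.
have cH : H (f q) @[q --> p] --> dh.
  apply/cvgrPdist_le => e e0.
  have [d d0 Hd] := is_derive_eps Dh e0.
  move/cvgrPdist_lt : cf => /(_ d d0); apply: filterS => q.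
  rewrite distrC => /Hd; rewrite /H; case: eqVneq => [_ _|qp].
    by rewrite subrr normr0 ltW.
  have q0 : f q - f p != 0 by rewrite subr_eq0.
  rewrite -ler_pdivrMr ?normr_gt0 // -normrV ?unitfE // -normrM.
  by rewrite mulrBl mulfK // distrC.
exists (fun q => H (f q) * s1 q), (fun q => H (f q) * s2 q); split => /=.
- exact: cvgM.
- exact: cvgM.
- by move=> q; rewrite HE E; ring.
Qed.

Lemma has_grad_eps f p g : has_grad f p g -> forall e : R, 0 < e ->
  \forall q \near p, `|f q - f p - (g.1 * (q.1 - p.1) + g.2 * (q.2 - p.2))| <=
     e * (`|q.1 - p.1| + `|q.2 - p.2|).
Proof.
move=> [s1 [s2 [c1 c2 E]]] e e0.
move/cvgrPdist_le : c1 => /(_ e e0) c1; move/cvgrPdist_le : c2 => /(_ e e0) c2.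
near=> q; rewrite E.
have h1 : `|g.1 - s1 q| <= e by near: q.
have h2 : `|g.2 - s2 q| <= e by near: q.
rewrite (_ : _ - _ = (s1 q - g.1) * (q.1 - p.1) + (s2 q - g.2) * (q.2 - p.2));
  last by ring.
apply: (le_trans (ler_normD _ _)); rewrite !normrM mulrDr.
by rewrite lerD // ler_wpM2r // distrC.
Unshelve. all: by end_near. Qed.

End has_grad.

Definition pt {R : realType} (v : 'cV[R]_2) : R * R := (z1 v, z2 v).

Lemma z1_le_enorm (R : realType) (v : 'cV[R]_2) : `|z1 v| <= enorm v.
Proof.
by rewrite /enorm -sqrtr_sqr ler_wsqrtr // lerDl sqr_ge0.
Qed.

Lemma z2_le_enorm (R : realType) (v : 'cV[R]_2) : `|z2 v| <= enorm v.
Proof.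
by rewrite /enorm -sqrtr_sqr ler_wsqrtr // lerDr sqr_ge0.
Qed.

Lemma z1B (R : realType) (u v : 'cV[R]_2) : z1 (u - v) = z1 u - z1 v.
Proof. by rewrite /z1 !mxE. Qed.

Lemma z2B (R : realType) (u v : 'cV[R]_2) : z2 (u - v) = z2 u - z2 v.
Proof. by rewrite /z2 !mxE. Qed.

Lemma abs_continuous_unif (R : realType) (a b : R) (z : R -> 'cV[R]_2) :
  abs_continuous a b z -> forall e : R, 0 < e -> exists2 d : R, 0 < d &
  forall s t, a <= s -> s <= b -> a <= t -> t <= b -> `|t - s| < d ->
    enorm (z t - z s) < e.
Proof.
move=> ac e e0; have [d d0 Hd] := ac e e0; exists d => //.
have H s t : a <= s -> s <= t -> t <= b -> t - s < d -> enorm (z t - z s) < e.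
  move=> as_ st tb std; have := Hd [:: (s, t)].
  by rewrite /= as_ st tb !big_seq1 /= => /(_ isT isT std).
move=> s t as_ sb at_ tb; have [st|ts] := leP s t.
  by rewrite ger0_norm ?subr_ge0 //; exact: H.
rewrite distrC enormC ger0_norm ?subr_ge0 ?(ltW ts) //; apply: H => //.
exact: ltW.
Qed.

Lemma abs_continuous_bounded (R : realType) (a b : R) (z : R -> 'cV[R]_2) :
  a <= b -> abs_continuous a b z ->
  exists M, forall t, a <= t <= b -> `|z1 (z t)| <= M /\ `|z2 (z t)| <= M.
Proof.
move=> ab ac.
have [d d0 Hd] := abs_continuous_unif ac ltr01.
pose P t := exists M, forall s, a <= s <= t -> `|z1 (z s)| <= M /\ `|z2 (z s)| <= M.
apply: (@real_induction R a b P) => //.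
  exists (`|z1 (z a)| + `|z2 (z a)|) => s; rewrite -eq_le => /eqP <-.
  by rewrite lerDl lerDr !normr_ge0.
move=> c /andP[ac' cb]; exists (d / 2); first by rewrite divr_gt0.
move=> s t as_ sc ct tb h1 h2 [M HM]; exists (M + 1) => r /andP[ar rt].
have [rs|sr] := leP r s.
  have [] := HM r; first by rewrite ar.
  by lra.
have [] := HM s; first by rewrite as_ lexx.
have sb : s <= b by lra.
have rb : r <= b by lra.
have : enorm (z r - z s) < 1.
  by apply: Hd => //; rewrite ger0_norm; lra.
have := z1_le_enorm (z r - z s); have := z2_le_enorm (z r - z s).
rewrite z1B z2B => h3 h4 h5 h6 h7.
have := ler_normD (z1 (z r) - z1 (z s)) (z1 (z s)).
have := ler_normD (z2 (z r) - z2 (z s)) (z2 (z s)).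
by rewrite !subrK; lra.
Qed.

Definition vfield {R : realType} (K1 K2 B1 B2 : R) (p : R * R) : R * R :=
  (p.2, if p.2 * ((K1 - K2) * p.1 + (B1 - B2) * p.2) <= 0
        then - K1 * p.1 - B1 * p.2 else - K2 * p.1 - B2 * p.2).

Lemma Amx_mul (R : realType) (K B : R) (v : 'cV[R]_2) :
  z1 (Amx K B *m v) = z2 v /\ z2 (Amx K B *m v) = - K * z1 v - B * z2 v.
Proof.
rewrite /z1 /z2 !mxE !big_ord_recl !big_ord0 !mxE /=.
rewrite (_ : lift ord0 ord0 = 1); last exact/val_inj.
by split; ring.
Qed.

Lemma is_derive_coord (R : realType) (z : R -> 'cV[R]_2) (t : R) (v : 'cV[R]_2) :
  is_derive t 1 z v ->
  is_derive t 1 (fun s => z1 (z s)) (z1 v) /\ is_derive t 1 (fun s => z2 (z s)) (z2 v).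
Proof.
move=> [dz <-]; have dij := (derivable_mxP _ _ _).1 dz.
by rewrite /z1 /z2 derive_mx // !mxE; split; apply: derivableP.
Qed.

Lemma Sigma_w_vfield (R : realType) (K1 K2 B1 B2 t0 : R) (z : R -> 'cV[R]_2) :
  Sigma_w K1 K2 B1 B2 t0 z -> exists2 N : set R,
   (@lebesgue_measure R).-negligible N & forall t, t0 <= t -> ~ N t ->
   is_derive t 1 (fun s => z1 (z s)) (vfield K1 K2 B1 B2 (pt (z t))).1 /\
   is_derive t 1 (fun s => z2 (z s)) (vfield K1 K2 B1 B2 (pt (z t))).2.
Proof.
move=> [_ ae]; eexists; first exact: ae.
move=> t tt /contrapT /(_ tt) [h1 h2]; rewrite /vfield /=.
case: ifPn => [h|]; [|rewrite -ltNge => h].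
  have := is_derive_coord (h1 h).
  by have [-> ->] := Amx_mul K1 B1 (z t).
have := is_derive_coord (h2 h).
by have [-> ->] := Amx_mul K2 B2 (z t).
Qed.

Lemma piecewise_increment (R : realType) (C kappa : R) (F : R * R -> R * R)
    (H : set (R * R)) (I : finType) (D : I -> set (R * R))
    (Q : I -> R * R -> R) (g : I -> R * R -> R * R) (V : R * R -> R) :
  0 <= C -> F (0, 0) = (0, 0) ->
  (forall i, closed (D i)) ->
  (forall p, H p -> exists i, D i p) ->
  (forall i p, H p -> D i p -> V p = Q i p) ->
  (forall p, H p -> `|V p| <= C * (p.1 ^+ 2 + p.2 ^+ 2)) ->
  (forall i p, H p -> D i p -> p != 0 ->
     [/\ has_grad (Q i) p (g i p),
         `|(g i p).1| <= C * (`|p.1| + `|p.2|),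
         `|(g i p).2| <= C * (`|p.1| + `|p.2|) &
         (g i p).1 * (F p).1 + (g i p).2 * (F p).2 <= - kappa * V p]) ->
  forall p, H p -> forall e : R, 0 < e -> exists2 d : R, 0 < d &
    forall q, H q -> `|q.1 - p.1| < d -> `|q.2 - p.2| < d -> exists l : R * R,
    [/\ `|l.1| <= C * (`|p.1| + `|p.2|), `|l.2| <= C * (`|p.1| + `|p.2|),
        l.1 * (F p).1 + l.2 * (F p).2 <= - kappa * V p &
        `|V q - V p - (l.1 * (q.1 - p.1) + l.2 * (q.2 - p.2))| <=
          e * (`|q.1 - p.1| + `|q.2 - p.2|)].
Proof.
move=> C0 F0 Dcl Dcov VQ VC grad p Hp e e0.
have [p0|pn0] := eqVneq p 0.
  have V0 : V 0 = 0.
    apply/eqP; rewrite -normr_le0 -{1}p0; apply: (le_trans (VC _ Hp)).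
    by rewrite p0 /= expr2 mulr0 addr0 mulr0.
  rewrite p0; exists (e / (C + 1)); first by rewrite divr_gt0 // ltr_wpDl.
  move=> q Hq; rewrite /= !subr0 => q1 q2; exists (0, 0).
  rewrite /= normr0 !mul0r !addr0 !mulr0 V0 mulr0 !subr0; split => //.
  apply: (le_trans (VC _ Hq)).
  have C1 : 0 < C + 1 by rewrite ltr_wpDl.
  move: q1 q2; rewrite !ltr_pdivlMr // => q1 q2.
  rewrite mulrDr -(real_normK (num_real q.1)) -(real_normK (num_real q.2)) !expr2 mulrDr.
  have n1 := normr_ge0 q.1; have n2 := normr_ge0 q.2.
  apply: lerD; rewrite mulrA ler_wpM2r //; nra.
have near_all : \forall q \near p, forall i, H p -> D i q ->
    D i p /\ `|Q i q - Q i p - ((g i p).1 * (q.1 - p.1) + (g i p).2 * (q.2 - p.2))|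
      <= e * (`|q.1 - p.1| + `|q.2 - p.2|).
  apply: (@filter_forall _ I (fun i q => H p -> D i q -> D i p /\
    `|Q i q - Q i p - ((g i p).1 * (q.1 - p.1) + (g i p).2 * (q.2 - p.2))|
      <= e * (`|q.1 - p.1| + `|q.2 - p.2|)) (nbhs p)) => i.
  have [Dp|Dp] := pselect (D i p).
    have [hg _ _ _] := grad i p Hp Dp pn0.
    by apply: filterS (has_grad_eps hg e0) => q.
  have : nbhs p (~` D i) by apply: open_nbhs_nbhs; split => //; exact: closed_openC.
  by apply: filterS => q nDq _ /nDq.
move/nbhs_ballP : near_all => [d /= d0 Hd]; exists d => // q Hq q1 q2.
have [i Diq] := Dcov q Hq.
have [|Dp h] := Hd q _ i Hp Diq.
  by split; rewrite /ball /= distrC.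
have [_ h1 h2 h3] := grad i p Hp Dp pn0.
by exists (g i p); split => //; rewrite (VQ i q) // (VQ i p).
Qed.

(** Only the field at the current point enters, so neither the order of the switchings nor their
    number matters. The rate [kappa] may be negative; a growth bound of this kind yields the
    invariance of a half-plane. *)
Lemma lyapunov_decay (R : realType) (K1 K2 B1 B2 t0 C kappa : R)
    (H : set (R * R)) (I : finType) (D : I -> set (R * R))
    (Q : I -> R * R -> R) (g : I -> R * R -> R * R) (V : R * R -> R)
    (z : R -> 'cV[R]_2) (F := vfield K1 K2 B1 B2) :
  Sigma_w K1 K2 B1 B2 t0 z -> (forall t, t0 <= t -> H (pt (z t))) ->
  0 <= C ->
  (forall i, closed (D i)) ->
  (forall p, H p -> exists i, D i p) ->
  (forall i p, H p -> D i p -> V p = Q i p) ->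
  (forall p, H p -> `|V p| <= C * (p.1 ^+ 2 + p.2 ^+ 2)) ->
  (forall i p, H p -> D i p -> p != 0 ->
     [/\ has_grad (Q i) p (g i p),
         `|(g i p).1| <= C * (`|p.1| + `|p.2|),
         `|(g i p).2| <= C * (`|p.1| + `|p.2|) &
         (g i p).1 * (F p).1 + (g i p).2 * (F p).2 <= - kappa * V p]) ->
  forall t, t0 <= t -> V (pt (z t)) <= expR (- kappa * (t - t0)) * V (pt (z t0)).
Proof.
move=> Sz Hz C0 Dcl Dcov VQ VC grad t tt.
have F0 : F (0, 0) = (0, 0) by rewrite /F /vfield /= !mulr0 addr0 !subr0 if_same.
have key := @piecewise_increment R C kappa F H I D Q g V C0 F0 Dcl Dcov VQ VC grad.
have [N N0 HN] := Sigma_w_vfield Sz.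
have [ac _] := Sz; have {}ac := ac t tt.
have [M HM] := abs_continuous_bounded tt ac.
have M0 : 0 <= M by have [] := HM t0; [rewrite lexx|move=> /(le_trans (normr_ge0 _))].
have Hc c : t0 <= c <= t -> H (pt (z c)) by move=> /andP[h _]; exact: Hz.
have grow c : t0 <= c <= t -> C * (`|z1 (z c)| + `|z2 (z c)|) <= C * (M + M).
  by move=> /HM [h1 h2]; rewrite ler_wpM2l // lerD.
have G0 : 0 <= C * (M + M) by rewrite mulr_ge0 // addr_ge0.
apply: (@ac_gronwall R t0 t (2 * (C * (M + M) + 1)) kappa (C * (M ^+ 2 + M ^+ 2))
  (fun s => V (pt (z s))) z N) => //.
- by rewrite mulr_ge0 // addr_ge0.
- move=> c ct; apply: (le_trans (VC _ (Hc c ct))); rewrite ler_wpM2l // /pt /=.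
  by have [h1 h2] := HM c ct; apply: lerD; rewrite -(real_normK (num_real _)) lerXn2r ?nnegrE.
- move=> c ct; have [d d0 Hd] := key _ (Hc c ct) 1 ltr01.
  have [d' d'0 Hd'] := abs_continuous_unif ac d0.
  exists d' => // s st sc; have /andP[c1 c2] := ct; have /andP[s1 s2] := st.
  have n : enorm (z s - z c) < d by apply: Hd'.
  have n1 := z1_le_enorm (z s - z c); have n2 := z2_le_enorm (z s - z c).
  rewrite z1B in n1; rewrite z2B in n2.
  have [||l [l1 l2 _ l4]] := Hd (pt (z s)) (Hc s st).
  + exact: le_lt_trans n.
  + exact: le_lt_trans n.
  rewrite /pt /= in l1 l2 l4 *.
  have g1 := le_trans l1 (grow c ct); have g2 := le_trans l2 (grow c ct).
  have m1 : `|l.1 * (z1 (z s) - z1 (z c))| <= C * (M + M) * enorm (z s - z c).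
    by rewrite normrM ler_pM.
  have m2 : `|l.2 * (z2 (z s) - z2 (z c))| <= C * (M + M) * enorm (z s - z c).
    by rewrite normrM ler_pM.
  have := ler_normD (V (z1 (z s), z2 (z s)) - V (z1 (z c), z2 (z c)) -
    (l.1 * (z1 (z s) - z1 (z c)) + l.2 * (z2 (z s) - z2 (z c))))
    (l.1 * (z1 (z s) - z1 (z c)) + l.2 * (z2 (z s) - z2 (z c))).
  rewrite subrK => h; apply: (le_trans h).
  have := ler_normD (l.1 * (z1 (z s) - z1 (z c))) (l.2 * (z2 (z s) - z2 (z c))).
  by rewrite mul1r in l4; lra.
- move=> c ct Nc e e0; have /andP[c1 c2] := ct.
  have [D1 D2] := HN c c1 Nc.
  set f := vfield K1 K2 B1 B2 (pt (z c)) in D1 D2.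
  (* [A] dominates the coefficients of [eta]: [C * (M + M)] for each remainder of a coordinate
     multiplied by [l], and [|f.1| + 1], [|f.2| + 1] for the sizes of the coordinate increments in
     the remainder of [V]. *)
  pose A := C * (M + M) + C * (M + M) + (`|f.1| + 1 + (`|f.2| + 1)) + 1.
  have A0 : 0 < A.
    by rewrite /A; have := normr_ge0 f.1; have := normr_ge0 f.2; lra.
  pose eta := Num.min 1 (e / A).
  have eta0 : 0 < eta by rewrite lt_min ltr01 divr_gt0.
  have eta1 : eta <= 1 by rewrite ge_min lexx.
  have etaA : eta * A <= e by rewrite -ler_pdivlMr // ge_min lexx orbT.
  have [d d0 Hd] := key _ (Hc c ct) eta eta0.
  have [d' d'0 Hd'] := abs_continuous_unif ac d0.
  have [d1 d10 E1] := is_derive_eps D1 eta0.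
  have [d2 d20 E2] := is_derive_eps D2 eta0.
  exists (Num.min d' (Num.min d1 d2)); first by rewrite !lt_min d'0 d10.
  move=> s st; rewrite !lt_min => /and3P[sd sd1 sd2]; have /andP[s1 s2] := st.
  have {}E1 := E1 s sd1; have {}E2 := E2 s sd2.
  have n : enorm (z s - z c) < d by apply: Hd'.
  have n1 := z1_le_enorm (z s - z c); have n2 := z2_le_enorm (z s - z c).
  rewrite z1B in n1; rewrite z2B in n2.
  have [||l [l1 l2 l3 l4]] := Hd (pt (z s)) (Hc s st).
  + exact: le_lt_trans n.
  + exact: le_lt_trans n.
  have g1 := le_trans l1 (grow c ct); have g2 := le_trans l2 (grow c ct).
  rewrite -/f in l3.
  move: l4; rewrite /pt /= -/(pt (z s)) -/(pt (z c)).
  set dx := z1 (z s) - z1 (z c) in E1 *; set dy := z2 (z s) - z2 (z c) in E2 *.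
  set dV := V (pt (z s)) - V (pt (z c)) => l4.
  have total : `|dV - (l.1 * f.1 + l.2 * f.2) * (s - c)| <= e * `|s - c|.
    have a0 := normr_ge0 (s - c).
    have bx : `|dx| <= (`|f.1| + 1) * `|s - c|.
      have := ler_normD (dx - f.1 * (s - c)) (f.1 * (s - c)).
      rewrite subrK normrM.
      have := ler_wpM2r a0 eta1; lra.
    have b_y : `|dy| <= (`|f.2| + 1) * `|s - c|.
      have := ler_normD (dy - f.2 * (s - c)) (f.2 * (s - c)).
      rewrite subrK normrM.
      have := ler_wpM2r a0 eta1; lra.
    have m1 : `|l.1 * (dx - f.1 * (s - c))| <= C * (M + M) * (eta * `|s - c|).
      by rewrite normrM ler_pM.
    have m2 : `|l.2 * (dy - f.2 * (s - c))| <= C * (M + M) * (eta * `|s - c|).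
      by rewrite normrM ler_pM.
    rewrite (_ : dV - _ = (dV - (l.1 * dx + l.2 * dy)) +
      (l.1 * (dx - f.1 * (s - c)) + l.2 * (dy - f.2 * (s - c)))); last by ring.
    apply: (le_trans (ler_normD _ _)).
    have := ler_normD (l.1 * (dx - f.1 * (s - c))) (l.2 * (dy - f.2 * (s - c))).
    have : eta * (`|dx| + `|dy|) <=
        eta * ((`|f.1| + 1) * `|s - c| + (`|f.2| + 1) * `|s - c|).
      by rewrite ler_wpM2l ?(ltW eta0) // lerD.
    have := ler_wpM2r a0 etaA.
    have := mulr_ge0 (ltW eta0) a0.
    rewrite /A; lra.
  split => sc.
    move: total; rewrite [`|s - c|]ger0_norm ?subr_ge0 // => total.
    have := le_trans (ler_norm _) total.
    have h0 : 0 <= s - c by rewrite subr_ge0.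
    have := ler_wpM2r h0 l3; lra.
  move: total; rewrite [`|s - c|]distrC [`|c - s|]ger0_norm ?subr_ge0 //.
  rewrite -normrN => total.
  have := le_trans (ler_norm _) total.
  have h0 : 0 <= c - s by rewrite subr_ge0.
  have := ler_wpM2r h0 l3; rewrite /dV; lra.
Qed.

(** * The switched system *)

Lemma GUAS_exponential (R : realType) (sol : R -> (R -> 'cV[R]_2) -> Prop) (M k : R) :
  0 < M -> 0 < k ->
  (forall t0 z, sol t0 z -> forall t, t0 <= t ->
     enorm (z t) <= M * expR (- k * (t - t0)) * enorm (z t0)) ->
  GUAS sol.
Proof.
move=> M0 k0 H; exists (fun r s => M * expR (- k * s) * r); last first.
  by move=> t0 z sz t tt; exact: H.
split.
- apply: continuous_subspaceT => p /=.
  apply: cvgM; last exact: cvg_fst.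
  apply: cvgM; first exact: cvg_cst.
  apply: continuous_cvg; first exact: continuous_expR.
  by apply: cvgM; [exact: cvg_cst|exact: cvg_snd].
- by move=> s _; rewrite mulr0.
- by move=> s r r' _ _ rr; rewrite ltr_pM2l // mulr_gt0 // expR_gt0.
- move=> r s s' r0 _ ss; rewrite ler_wpM2r // ler_wpM2l ?(ltW M0) // ler_expR.
  by rewrite !mulNr lerN2 ler_wpM2l // ltW.
- move=> r r0; rewrite -[X in _ --> X](mul0r r); apply: cvgM; last exact: cvg_cst.
  rewrite -[X in _ --> X](mulr0 M); apply: cvgM; first exact: cvg_cst.
  have -> : (fun s => expR (- k * s)) = (fun y => expR (- y)) \o (fun s : R => k * s).
    by apply/funext => s /=; rewrite mulNr.
  apply: cvg_comp; last exact: cvgr_expR.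
  exact: gt0_cvgMry.
Qed.

Lemma GUAS_energy (R : realType) (sol : R -> (R -> 'cV[R]_2) -> Prop) (m C k : R) :
  0 < m -> 0 < C -> 0 < k ->
  (forall t0 z, sol t0 z -> forall t, t0 <= t ->
     m * (z1 (z t) ^+ 2 + z2 (z t) ^+ 2) <=
     expR (- k * (t - t0)) * (C * (z1 (z t0) ^+ 2 + z2 (z t0) ^+ 2))) ->
  GUAS sol.
Proof.
move=> m0 C0 k0 H; apply: (@GUAS_exponential _ _ (Num.sqrt (C / m)) (k / 2)).
- by rewrite sqrtr_gt0 divr_gt0.
- exact: divr_gt0.
move=> t0 z sz t tt; have := H t0 z sz t tt.
rewrite mulrC -ler_pdivlMr // => h.
rewrite /enorm; apply: (le_trans (ler_wsqrtr h)).
have -> : expR (- (k / 2) * (t - t0)) = Num.sqrt (expR (- k * (t - t0))).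
  apply: (@pexpIrn _ 2) => //; rewrite ?nnegrE ?expR_ge0 ?sqrtr_ge0 //.
  rewrite sqr_sqrtr ?expR_ge0 // expr2 -expRD; by congr expR; field.
rewrite -!sqrtrM ?mulr_ge0 ?expR_ge0 ?invr_ge0 ?(ltW C0) ?(ltW m0) //.
rewrite le_eqVlt; apply/orP; left; apply/eqP; congr Num.sqrt.
by field; rewrite gt_eqF.
Qed.

(** Central symmetry reduces the study of an invariant line to one of its two sides. *)
Lemma Sigma_wN (R : realType) (K1 K2 B1 B2 t0 : R) (z : R -> 'cV[R]_2) :
  Sigma_w K1 K2 B1 B2 t0 z -> Sigma_w K1 K2 B1 B2 t0 (fun t => - z t).
Proof.
move=> [ac ae]; split.
  move=> t1 t01 e e0; have [d d0 Hd] := ac t1 t01 e e0; exists d => // s h1 h2 h3.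
  have := Hd s h1 h2 h3; congr (_ < _); apply: eq_bigr => p _.
  by rewrite -opprD enormN.
have N1 (v : 'cV[R]_2) : z1 (- v) = - z1 v by rewrite /z1 !mxE.
have N2 (v : 'cV[R]_2) : z2 (- v) = - z2 v by rewrite /z2 !mxE.
have qN (v : 'cV[R]_2) : z2 (- v) * ((K1 - K2) * z1 (- v) + (B1 - B2) * z2 (- v)) =
  z2 v * ((K1 - K2) * z1 v + (B1 - B2) * z2 v) by rewrite N1 N2; ring.
move: ae => [A [mA A0 sub]]; exists A; split => // t nt; apply: sub => Ht.
apply: nt => tt; have [H1 H2] := Ht tt.
split; rewrite /S1 /S2 /= qN mulmxN => h.
  by apply: is_deriveN; exact: H1.
by apply: is_deriveN; exact: H2.
Qed.

Section vfield.
Context {R : realType}.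
Variables (K1 K2 B1 B2 : R).
Implicit Types p : R * R.

Local Notation F2 p := (vfield K1 K2 B1 B2 p).2.

Lemma vfield_cases p : F2 p = - K1 * p.1 - B1 * p.2 \/ F2 p = - K2 * p.1 - B2 * p.2.
Proof. by rewrite /vfield /=; case: ifP => _; [left|right]. Qed.

Lemma vfield_axis p : p.2 = 0 -> F2 p = - K1 * p.1.
Proof. by move=> p2; rewrite /vfield /= p2 mul0r lexx mulr0 subr0. Qed.

Lemma vfield_upper p : 0 < p.2 ->
  - K1 * p.1 - B1 * p.2 <= F2 p /\ - K2 * p.1 - B2 * p.2 <= F2 p.
Proof.
move=> p2; rewrite /vfield /=; case: ifPn; rewrite pmulr_rle0 // => h.
  by split => //; lra.
by rewrite -ltNge in h; split => //; lra.
Qed.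

Lemma vfield_lower p : p.2 < 0 ->
  F2 p <= - K1 * p.1 - B1 * p.2 /\ F2 p <= - K2 * p.1 - B2 * p.2.
Proof.
move=> p2; rewrite /vfield /=; case: ifPn; rewrite nmulr_rle0 // => h.
  by split => //; lra.
by rewrite -ltNge in h; split => //; lra.
Qed.

End vfield.

Section quad.
Context {R : realType}.

Definition quad (k : R * R * R) (q : R * R) : R :=
  k.1.1 * q.1 ^+ 2 + k.1.2 * (q.1 * q.2) + k.2 * q.2 ^+ 2.

Definition quad_grad (k : R * R * R) (q : R * R) : R * R :=
  (2 * k.1.1 * q.1 + k.1.2 * q.2, k.1.2 * q.1 + 2 * k.2 * q.2).

Definition quad_norm (k : R * R * R) : R := 2 * `|k.1.1| + `|k.1.2| + 2 * `|k.2|.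

Lemma quad_norm_ge0 k : 0 <= quad_norm k.
Proof. by rewrite /quad_norm !addr_ge0 // mulr_ge0. Qed.

Lemma has_grad_quad k p : has_grad (quad k) p (quad_grad k p).
Proof.
exists (fun q => k.1.1 * (q.1 + p.1) + k.1.2 * q.2),
       (fun q => k.1.2 * p.1 + k.2 * (q.2 + p.2)); split.
- rewrite /quad_grad /= (_ : 2 * k.1.1 * p.1 = k.1.1 * (p.1 + p.1)); last by ring.
  apply: cvgD; apply: cvgM; try exact: cvg_cst; last exact: cvg_snd.
  by apply: cvgD; [exact: cvg_fst|exact: cvg_cst].
- rewrite /quad_grad /=; apply: cvgD; first exact: cvg_cst.
  rewrite (_ : 2 * k.2 * p.2 = k.2 * (p.2 + p.2)); last by ring.
  apply: cvgM; first exact: cvg_cst.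
  by apply: cvgD; [exact: cvg_snd|exact: cvg_cst].
- by move=> q; rewrite /quad; ring.
Qed.

Lemma quad_le k q : `|quad k q| <= quad_norm k * (q.1 ^+ 2 + q.2 ^+ 2).
Proof.
rewrite /quad /quad_norm.
have h1 := sqr_ge0 q.1; have h2 := sqr_ge0 q.2.
have h3 : `|q.1 * q.2| <= q.1 ^+ 2 + q.2 ^+ 2.
  rewrite normrM -(real_normK (num_real q.1)) -(real_normK (num_real q.2)).
  have := normr_ge0 q.1; have := normr_ge0 q.2; nra.
apply: (le_trans (ler_normD _ _)); apply: (le_trans (lerD (ler_normD _ _) (lexx _))).
rewrite [`|k.1.1 * _|]normrM [`|k.1.2 * _|]normrM [`|k.2 * _|]normrM.
rewrite (ger0_norm h1) (ger0_norm h2).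
have := ler_wpM2l (normr_ge0 k.1.2) h3.
have := mulr_ge0 (normr_ge0 k.1.1) h1; have := mulr_ge0 (normr_ge0 k.2) h1.
have := mulr_ge0 (normr_ge0 k.1.1) h2; have := mulr_ge0 (normr_ge0 k.2) h2.
lra.
Qed.

Lemma quad_grad_le k q :
  `|(quad_grad k q).1| <= quad_norm k * (`|q.1| + `|q.2|) /\
  `|(quad_grad k q).2| <= quad_norm k * (`|q.1| + `|q.2|).
Proof.
rewrite /quad_grad /quad_norm /=.
have n1 := normr_ge0 q.1; have n2 := normr_ge0 q.2.
have a := normr_ge0 k.1.1; have b := normr_ge0 k.1.2; have c := normr_ge0 k.2.
have a1 := mulr_ge0 a n1; have b1 := mulr_ge0 b n1; have c1 := mulr_ge0 c n1.
have a2 := mulr_ge0 a n2; have b2 := mulr_ge0 b n2; have c2 := mulr_ge0 c n2.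
by split; apply: (le_trans (ler_normD _ _)); rewrite !normrM (ger0_norm (ler0n _ 2)); lra.
Qed.

End quad.

(** * An invariant line *)

Lemma closed_halfplane (R : realType) (a b : R) :
  closed [set q : R * R | 0 <= a * q.1 + b * q.2].
Proof.
apply: (@preimage_closed _ _ (fun q : R * R => a * q.1 + b * q.2) [set x | 0 <= x]).
  by move=> q _; exact: has_grad_cvg (has_grad_linear a b q).
exact: closed_ge.
Qed.

(* [(1, - mu)] is an eigenvector of the active matrix: since [z2 * F2] is the
   maximum of [z2 * (A_i z)_2], the active matrix [A_i] at that vector is the one
   with the smaller [(B_i * mu - K_i)]. *)
Definition invariant_slope (R : realType) (K1 K2 B1 B2 mu : R) : Prop :=
  [/\ 0 < mu, mu ^+ 2 <= B1 * mu - K1, mu ^+ 2 <= B2 * mu - K2 &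
      mu ^+ 2 = B1 * mu - K1 \/ mu ^+ 2 = B2 * mu - K2].

Section invariant_line.
Context {R : realType}.
Variables (K1 K2 B1 B2 mu : R).
Implicit Types p : R * R.

Local Notation w p := (mu * p.1 + p.2).

(** Above the axis the field dominates both linear ones, so it can be compared with the one having
    the eigenvector [(1, - mu)]. For that one the derivative of [w] is [- (B_i - mu) * w], and
    [mu < B_i] because [mu * (B_i - mu) = K_i]. *)
Lemma ray_second_quadrant p : 0 < K1 -> 0 < K2 ->
  invariant_slope K1 K2 B1 B2 mu -> p.1 <= 0 -> 0 <= p.2 -> w p <= 0 ->
  0 <= (vfield K1 K2 B1 B2 p).2 + mu * p.2.
Proof.
move=> K10 K20 [mu0 m1 m2 m] p1 p2 wp.
move: p2; rewrite le_eqVlt => /orP[/eqP p2|p2].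
  by rewrite vfield_axis // -p2 mulr0 addr0 mulNr oppr_ge0 pmulr_rle0.
have [u1 u2] := vfield_upper K1 K2 B1 B2 p2.
case: m => m.
  have e : - K1 * p.1 - B1 * p.2 + mu * p.2 = - (B1 - mu) * w p.
    have -> : K1 = B1 * mu - mu ^+ 2 by lra.
    by ring.
  have : mu < B1.
    by rewrite -subr_gt0 -(pmulr_rgt0 _ mu0) mulrBr -expr2 [mu * B1]mulrC; lra.
  by move=> h; have : 0 <= - (B1 - mu) * w p; [nra|lra].
have e : - K2 * p.1 - B2 * p.2 + mu * p.2 = - (B2 - mu) * w p.
  have -> : K2 = B2 * mu - mu ^+ 2 by lra.
  by ring.
have : mu < B2.
  by rewrite -subr_gt0 -(pmulr_rgt0 _ mu0) mulrBr -expr2 [mu * B2]mulrC; lra.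
by move=> h; have : 0 <= - (B2 - mu) * w p; [nra|lra].
Qed.

(** Here the inequalities on [mu] make both matrices suitable: beyond [mu * w p], the derivative of
    [w] consists of [(B_i * mu - K_i - mu ^+ 2) * p.1] and [- B_i * w p], both nonnegative. *)
Lemma ray_fourth_quadrant p : 0 < B1 -> 0 < B2 ->
  invariant_slope K1 K2 B1 B2 mu -> 0 <= p.1 -> w p <= 0 ->
  mu * w p <= (vfield K1 K2 B1 B2 p).2 + mu * p.2.
Proof.
move=> B10 B20 [mu0 m1 m2 m] p1 wp.
have [->|->] := vfield_cases K1 K2 B1 B2 p.
  have h : 0 <= (B1 * mu - K1 - mu ^+ 2) * p.1 by rewrite mulr_ge0 //; lra.
  have : 0 <= - B1 * w p by nra.
  rewrite (_ : _ + mu * p.2 = (B1 * mu - K1 - mu ^+ 2) * p.1 + (- B1 * w p) +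
    mu * w p); last by ring.
  lra.
have h : 0 <= (B2 * mu - K2 - mu ^+ 2) * p.1 by rewrite mulr_ge0 //; lra.
have : 0 <= - B2 * w p by nra.
rewrite (_ : _ + mu * p.2 = (B2 * mu - K2 - mu ^+ 2) * p.1 + (- B2 * w p) +
  mu * w p); last by ring.
lra.
Qed.

(** This one-sided estimate takes the place of uniqueness of solutions, which a discontinuous field
    does not provide. In the third quadrant [|w p|] is [mu * |p.1| + |p.2|] and dominates every term
    of the field, which explains the constant. *)
Lemma ray_growth p :
  0 < K1 -> 0 < K2 -> 0 < B1 -> 0 < B2 -> invariant_slope K1 K2 B1 B2 mu ->
  w p <= 0 ->
  w p * ((vfield K1 K2 B1 B2 p).2 + mu * p.2) <=
    ((K1 + K2) / mu + B1 + B2 + mu) * w p ^+ 2.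
Proof.
move=> K10 K20 B10 B20 hs wp; have [mu0 _ _ _] := hs.
set Cc := (_ + mu).
have q1 : 0 < K1 / mu by exact: divr_gt0.
have q2 : 0 < K2 / mu by exact: divr_gt0.
have Cmu : mu <= Cc by rewrite /Cc mulrDl; lra.
have w2 : 0 <= w p ^+ 2 by exact: sqr_ge0.
have C0 : 0 <= Cc * w p ^+ 2 by rewrite mulr_ge0 //; lra.
have [p1|p1] := leP 0 p.1.
  have h := ray_fourth_quadrant B10 B20 hs p1 wp.
  have : w p * ((vfield K1 K2 B1 B2 p).2 + mu * p.2) <= w p * (mu * w p).
    exact: ler_wnM2l.
  move=> /le_trans; apply.
  by rewrite mulrCA -expr2 ler_wpM2r.
have [p2|p2] := leP 0 p.2.
  have h := ray_second_quadrant K10 K20 hs (ltW p1) p2 wp.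
  by apply: (le_trans _ C0); rewrite mulr_le0_ge0.
suff h : Cc * w p <= (vfield K1 K2 B1 B2 p).2 + mu * p.2.
  have := ler_wnM2l wp h; rewrite mulrCA -expr2; exact.
have r1 : mu * (K1 / mu) = K1 by field; rewrite gt_eqF.
have r2 : mu * (K2 / mu) = K2 by field; rewrite gt_eqF.
have e : Cc * w p = (mu * (K1 / mu) + mu * (K2 / mu)) * p.1 +
  ((K1 / mu) + (K2 / mu)) * p.2 + (B1 + B2 + mu) * (mu * p.1) + (B1 + B2 + mu) * p.2.
  by rewrite /Cc; ring.
rewrite e r1 r2 => {e}.
have s1 : (K1 / mu + K2 / mu) * p.2 <= 0 by rewrite mulr_ge0_le0 ?(ltW p2) //; lra.
have s2 : (B1 + B2 + mu) * (mu * p.1) <= 0.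
  by rewrite mulr_ge0_le0 //; [lra|rewrite mulr_ge0_le0 ?(ltW p1) ?(ltW mu0)].
have k1 : K1 * p.1 <= 0 by rewrite mulr_ge0_le0 ?(ltW p1) ?(ltW K10).
have k2 : K2 * p.1 <= 0 by rewrite mulr_ge0_le0 ?(ltW p1) ?(ltW K20).
have b1 : B1 * p.2 <= 0 by rewrite mulr_ge0_le0 ?(ltW p2) ?(ltW B10).
have b2 : B2 * p.2 <= 0 by rewrite mulr_ge0_le0 ?(ltW p2) ?(ltW B20).
by have [->|->] := vfield_cases K1 K2 B1 B2 p; lra.
Qed.

(** [V] is the square of the negative part of [w]; it grows at most exponentially and starts from
    0. *)
Lemma halfplane_invariant t0 (z : R -> 'cV[R]_2) :
  0 < K1 -> 0 < K2 -> 0 < B1 -> 0 < B2 -> invariant_slope K1 K2 B1 B2 mu ->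
  Sigma_w K1 K2 B1 B2 t0 z -> 0 <= w (pt (z t0)) ->
  forall t, t0 <= t -> 0 <= w (pt (z t)).
Proof.
move=> K10 K20 B10 B20 hs Sz w0 t tt.
pose k : R * R * R := (mu ^+ 2, 2 * mu, 1).
pose V (q : R * R) := if 0 <= w q then 0 else quad k q.
have kE q : quad k q = w q ^+ 2 by rewrite /quad /=; ring.
pose D (b : bool) := [set q : R * R | if b then 0 <= mu * q.1 + 1 * q.2
                                      else 0 <= - mu * q.1 + - 1 * q.2].
pose Q (b : bool) := if b then quad (0, 0, 0) else quad k.
pose g (b : bool) := if b then quad_grad (0, 0, 0) else quad_grad k.
pose c := (K1 + K2) / mu + B1 + B2 + mu.
have zE q : quad (0, 0, 0) q = 0 :> R by rewrite /quad /= !mul0r !addr0.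
have DT q : D true q -> 0 <= w q by rewrite /D /= mul1r.
have DF q : D false q -> w q <= 0 by rewrite /D /=; lra.
have : V (pt (z t)) <= expR (- - (2 * c) * (t - t0)) * V (pt (z t0)).
  apply: (@lyapunov_decay R K1 K2 B1 B2 t0 (quad_norm k) (- (2 * c)) setT bool D Q g V z) => //.
  - exact: quad_norm_ge0.
  - by case; exact: closed_halfplane.
  - move=> q _; have [h|h] := leP 0 (w q); [exists true|exists false]; rewrite /D /=; lra.
  - move=> [] q _; rewrite /V /Q; first by move=> /DT ->; rewrite zE.
    move=> /DF h; case: ifP => // h'.
    have -> : quad k q = 0 by rewrite kE (_ : w q = 0) ?expr0n //; apply/eqP; rewrite eq_le h.
    by [].
  - move=> q _; rewrite /V; case: ifP => _; last exact: quad_le.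
    by rewrite normr0 mulr_ge0 ?quad_norm_ge0 // addr_ge0 // sqr_ge0.
  - move=> [] q _ Dq _; rewrite /Q /g.
      have -> : quad_grad (0, 0, 0) q = (0, 0) :> R * R.
        by rewrite /quad_grad /= !mulr0 !mul0r !addr0.
      rewrite /V (DT _ Dq) /= !mul0r !normr0 mulr0 addr0; split => //.
      + apply: (has_grad_eq (has_grad_quad (0,0,0) q)) => //.
          by rewrite /quad_grad /= !mulr0 !mul0r !addr0.
        by rewrite /quad_grad /= !mulr0 !mul0r !addr0.
      + by rewrite mulr_ge0 ?quad_norm_ge0 // addr_ge0.
      + by rewrite mulr_ge0 ?quad_norm_ge0 // addr_ge0.
    have [n1 n2] := quad_grad_le k q; split => //; first exact: has_grad_quad.
    have h := ray_growth K10 K20 B10 B20 hs (DF _ Dq).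
    have -> : V q = w q ^+ 2.
      rewrite /V kE; case: ifP => // h'.
      by rewrite (_ : w q = 0) ?expr0n //; apply/eqP; rewrite eq_le h' (DF _ Dq).
    have -> : (quad_grad k q).1 * (vfield K1 K2 B1 B2 q).1 +
       (quad_grad k q).2 * (vfield K1 K2 B1 B2 q).2 =
       2 * (w q * ((vfield K1 K2 B1 B2 q).2 + mu * q.2)).
      by set F2 := (vfield _ _ _ _ q).2; rewrite /quad_grad /k /=; ring.
    by rewrite opprK -mulrA ler_pM2l.
rewrite {2}/V w0 mulr0 /V; case: ifP => // /negbT; rewrite -ltNge => h.
by rewrite kE leNgt exprn_even_gt0 //= lt_eqF.
Qed.

End invariant_line.

Section invariant_halfplane_decay.
Context {R : realType}.
Variables (K1 K2 B1 B2 mu : R).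
Hypotheses (K1_gt0 : 0 < K1) (K12 : K1 < K2) (B1_gt0 : 0 < B1) (B2_gt0 : 0 < B2).
Hypothesis slope : invariant_slope K1 K2 B1 B2 mu.
Implicit Types p : R * R.

Let F p := vfield K1 K2 B1 B2 p.
Let b := Num.min B1 B2.
(** The form [lower_right] is [k * (p.1 + c * w p) ^+ 2]. In the fourth quadrant with [0 <= w p],
    the derivative of [w] is at most [- (K1 / mu) * w]; this [c] makes the derivative of
    [p.1 + c * w] at most [p.2 - 2 * w = - mu * p.1 - w]. The factor [k] gives the value
    [K1 * p.1 ^+ 2] on the axis, as for [upper_right]. *)
Let c := 2 * mu / K1.
Let k := K1 / (1 + c * mu) ^+ 2.

Local Notation w p := (mu * p.1 + p.2).

(* The three pieces have homogeneous degree two and agree on the half-axes. *)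
Let upper_left : R * R * R := (K2, 0, 1).
Let upper_right : R * R * R := (K1, b, 1).
Let lower_right : R * R * R :=
  (k * (1 + c * mu) ^+ 2, 2 * k * c * (1 + c * mu), k * c ^+ 2).

Let b_gt0 : 0 < b.
Proof. by rewrite lt_min B1_gt0. Qed.

Let K2_gt0 : 0 < K2. Proof. exact: lt_trans K12. Qed.

Let mu_gt0 : 0 < mu. Proof. by have [] := slope. Qed.

Let c_gt0 : 0 < c. Proof. by rewrite divr_gt0 ?mulr_gt0. Qed.

Let k_gt0 : 0 < k.
Proof. by rewrite divr_gt0 // exprn_gt0 // addr_gt0 // mulr_gt0. Qed.

(** The term [- K_i * p.1] is largest with [K2] to the left of the axis [z1 = 0] and with [K1] to
    its right, whence the coefficients of the two upper forms. *)
Lemma vfield_upper_left p : p.1 <= 0 -> 0 <= p.2 -> (F p).2 <= - K2 * p.1 - b * p.2.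
Proof.
move=> p1 p2; have m1 : b <= B1 by rewrite ge_min lexx.
have m2 : b <= B2 by rewrite ge_min lexx orbT.
rewrite /F; have [->|->] := vfield_cases K1 K2 B1 B2 p; last by nra.
have : K2 * p.1 <= K1 * p.1 by rewrite ler_wnM2r // ltW.
have : b * p.2 <= B1 * p.2 by rewrite ler_wpM2r.
lra.
Qed.

Lemma vfield_upper_right p : 0 <= p.1 -> 0 <= p.2 -> (F p).2 <= - K1 * p.1 - b * p.2.
Proof.
move=> p1 p2; have m1 : b <= B1 by rewrite ge_min lexx.
have m2 : b <= B2 by rewrite ge_min lexx orbT.
rewrite /F; have [->|->] := vfield_cases K1 K2 B1 B2 p; first by nra.
have : K1 * p.1 <= K2 * p.1 by rewrite ler_wpM2r // ltW.
have : b * p.2 <= B2 * p.2 by rewrite ler_wpM2r.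
lra.
Qed.

(** Below the axis both linear fields are upper bounds. The one with the eigenvector [(1, - mu)]
    gives [- (B_i - mu) * w], and [B_i - mu = K_i / mu] is at least [K1 / mu]. *)
Lemma vfield_lower_right p : 0 <= p.1 -> p.2 <= 0 -> 0 <= w p ->
  (F p).2 + mu * p.2 <= - (K1 / mu) * w p.
Proof.
move=> p1; rewrite le_eqVlt => /orP[/eqP p2|p2] wp.
  rewrite /F vfield_axis // p2 mulr0 !addr0.
  by rewrite [leRHS](_ : _ = - K1 * p.1) //; field; rewrite gt_eqF.
have [u1 u2] := vfield_lower K1 K2 B1 B2 p2.
have [_ _ _ [m|m]] := slope.
  have -> : K1 / mu = B1 - mu.
    by rewrite (_ : K1 = mu * (B1 - mu)); [field; rewrite gt_eqF|lra].
  have : K1 * p.1 = mu * (B1 - mu) * p.1 by congr (_ * _); lra.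
  by rewrite -/(F p) in u1 u2; lra.
have h2 : K2 / mu = B2 - mu.
  by rewrite (_ : K2 = mu * (B2 - mu)); [field; rewrite gt_eqF|lra].
have : K2 * p.1 = mu * (B2 - mu) * p.1 by congr (_ * _); lra.
have : K1 / mu * w p <= K2 / mu * w p.
  by rewrite ler_wpM2r // ler_pM2r ?invr_gt0 // ltW.
by rewrite h2; rewrite -/(F p) in u1 u2; lra.
Qed.

(** This energy only loses [2 * b * p.2 ^+ 2], but the invariant line keeps [p.2] above
    [- mu * p.1], so that [p.2 ^+ 2] controls the whole form. *)
Lemma upper_left_decay p kap : p.1 <= 0 -> 0 <= p.2 -> 0 <= w p ->
  0 <= kap -> kap * (mu ^+ 2 + K2) <= 2 * b * mu ^+ 2 ->
  (quad_grad upper_left p).1 * p.2 + (quad_grad upper_left p).2 * (F p).2 <=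
  - kap * quad upper_left p.
Proof.
move=> p1 p2 wp kap0 hk; have h := vfield_upper_left p1 p2.
move: h; set f := (F p).2 => h; rewrite /quad_grad /quad /upper_left /=.
have h1 : 2 * p.2 * f <= 2 * p.2 * (- K2 * p.1 - b * p.2).
  by rewrite ler_wpM2l // mulr_ge0.
have h2 : mu ^+ 2 * p.1 ^+ 2 <= p.2 ^+ 2.
  rewrite -exprMn -[leLHS]sqrrN lerXn2r ?nnegrE //; last by lra.
  by rewrite oppr_ge0 mulr_ge0_le0 // ltW.
have mu2 : 0 < mu ^+ 2 by rewrite exprn_gt0.
have h3 : kap * (K2 * p.1 ^+ 2 + p.2 ^+ 2) <= 2 * b * p.2 ^+ 2.
  rewrite -(ler_pM2r mu2).
  have a1 : kap * K2 * (mu ^+ 2 * p.1 ^+ 2) <= kap * K2 * p.2 ^+ 2.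
    by rewrite ler_wpM2l // mulr_ge0 // ltW.
  have a2 : kap * (mu ^+ 2 + K2) * p.2 ^+ 2 <= 2 * b * mu ^+ 2 * p.2 ^+ 2.
    by rewrite ler_wpM2r // sqr_ge0.
  lra.
lra.
Qed.

(** The cross term [b] gives decay up to the half-axis [p.2 = 0], where the plain energy has none.
    The coefficient [b * p.1 + 2 * p.2] of the field is nonnegative in this quadrant, so the upper
    bound on the field applies. *)
Lemma upper_right_decay p kap : 0 <= p.1 -> 0 <= p.2 ->
  0 <= kap -> kap * (2 + b) <= 2 * b -> kap * (2 * K1 + b) <= 2 * b * K1 ->
  (quad_grad upper_right p).1 * p.2 + (quad_grad upper_right p).2 * (F p).2 <=
  - kap * quad upper_right p.
Proof.
move=> p1 p2 kap0 hk hk'; have h := vfield_upper_right p1 p2.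
move: h; set f := (F p).2 => h; rewrite /quad_grad /quad /upper_right /=.
have h1 : (b * p.1 + 2 * 1 * p.2) * f <=
    (b * p.1 + 2 * 1 * p.2) * (- K1 * p.1 - b * p.2).
  by rewrite ler_wpM2l // addr_ge0 // mulr_ge0 // ?ltW // mulr1.
have b2 : 0 <= b ^+ 2 * (p.1 * p.2) by rewrite mulr_ge0 ?sqr_ge0 // mulr_ge0.
have kb : 0 <= kap * b by rewrite mulr_ge0 // ltW.
have h2 : kap * b * (2 * (p.1 * p.2)) <= kap * b * (p.1 ^+ 2 + p.2 ^+ 2).
  by rewrite ler_wpM2l //; have := sqr_ge0 (p.1 - p.2); lra.
have h3 : kap * (2 + b) * p.2 ^+ 2 <= 2 * b * p.2 ^+ 2.
  by rewrite ler_wpM2r // sqr_ge0.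
have h4 : kap * (2 * K1 + b) * p.1 ^+ 2 <= 2 * b * K1 * p.1 ^+ 2.
  by rewrite ler_wpM2r // sqr_ge0.
lra.
Qed.

Lemma lower_rightE p : quad lower_right p = k * (p.1 + c * w p) ^+ 2.
Proof. by rewrite /quad /lower_right /=; ring. Qed.

Lemma lower_right_decay p kap : 0 <= p.1 -> p.2 <= 0 -> 0 <= w p ->
  kap <= 2 * mu -> kap * c <= 2 ->
  (quad_grad lower_right p).1 * p.2 + (quad_grad lower_right p).2 * (F p).2 <=
  - kap * quad lower_right p.
Proof.
move=> p1 p2 wp hk hk'; have h := vfield_lower_right p1 p2 wp.
rewrite lower_rightE.
set u := p.1 + c * w p.
have u0 : 0 <= u by rewrite addr_ge0 // mulr_ge0 // ltW.
have -> : (quad_grad lower_right p).1 * p.2 + (quad_grad lower_right p).2 * (F p).2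
   = 2 * k * u * (p.2 + c * ((F p).2 + mu * p.2)).
  by rewrite /u /quad_grad /lower_right; set f := (F p).2; rewrite /=; ring.
rewrite (_ : - kap * _ = 2 * k * u * (- (kap / 2) * u)); last by field.
have ku : 0 <= 2 * k * u by apply: mulr_ge0 => //; apply: mulr_ge0 => //; exact: ltW.
apply: ler_wpM2l => //.
have h1 : c * ((F p).2 + mu * p.2) <= c * (- (K1 / mu) * w p).
  by rewrite ler_pM2l.
have h2 : c * (- (K1 / mu) * w p) = - 2 * w p.
  by rewrite /c; field; rewrite !gt_eqF.
have h3 : kap * p.1 <= 2 * mu * p.1 by rewrite ler_wpM2r.
have h4 : kap * c * w p <= 2 * w p by rewrite ler_wpM2r.
rewrite /u; lra.
Qed.

Let V (q : R * R) : R :=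
  if 0 <= q.2 then (if q.1 <= 0 then quad upper_left q else quad upper_right q)
  else quad lower_right q.

(** Three quadrants suffice, since the closed third one meets [H] only at the origin. *)
Let D (i : option bool) : set (R * R) := match i with
  | Some true => [set q | 0 <= -1 * q.1 + 0 * q.2] `&` [set q | 0 <= 0 * q.1 + 1 * q.2]
  | Some false => [set q | 0 <= 1 * q.1 + 0 * q.2] `&` [set q | 0 <= 0 * q.1 + 1 * q.2]
  | None => [set q | 0 <= 1 * q.1 + 0 * q.2] `&` [set q | 0 <= 0 * q.1 + -1 * q.2]
  end.

Let coef (i : option bool) := match i with
  | Some true => upper_left | Some false => upper_right | None => lower_right end.

Let H : set (R * R) := [set q | 0 <= w q].

Let D_closed i : closed (D i).
Proof. by case: i => [[]|]; apply: closedI; exact: closed_halfplane. Qed.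

Let DE i q : D i q -> match i with
  | Some true => q.1 <= 0 /\ 0 <= q.2
  | Some false => 0 <= q.1 /\ 0 <= q.2
  | None => 0 <= q.1 /\ q.2 <= 0 end.
Proof. by case: i => [[]|] [/=]; lra. Qed.

Let D_cover q : H q -> exists i, D i q.
Proof.
move=> wq; have [q2|q2] := leP 0 q.2.
  have [q1|q1] := leP q.1 0; first by exists (Some true); split => /=; lra.
  by exists (Some false); split => /=; lra.
exists None; split => /=; last lra.
suff : 0 < q.1 by lra.
by rewrite -(pmulr_rgt0 _ mu_gt0); move: wq; rewrite /H /=; lra.
Qed.

Let kE : k * (1 + c * mu) ^+ 2 = K1.
Proof.
by rewrite /k divfK // expf_neq0 // gt_eqF // addr_gt0 // mulr_gt0.
Qed.

Let V_piece i q : H q -> D i q -> V q = quad (coef i) q.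
Proof.
move=> wq /DE; rewrite /V /quad /coef.
case: i => [[]|] [q1 q2].
- by rewrite q2 q1.
- rewrite q2; case: ifP => // q1'.
  have -> : q.1 = 0 by apply/eqP; rewrite eq_le q1 q1'.
  by rewrite /=; ring.
- case: ifP => // q2'.
  have e : q.2 = 0 by apply/eqP; rewrite eq_le q2 q2'.
  case: ifP => q1'.
    have -> : q.1 = 0 by apply/eqP; rewrite eq_le q1 q1'.
    by rewrite e; ring.
  by rewrite e /= kE; ring.
Qed.

Let m := Num.min (Num.min 1 K1) (k / (1 + mu ^+ 2)).

Let m_gt0 : 0 < m.
Proof.
rewrite !lt_min ltr01 K1_gt0 /= divr_gt0 // addr_gt0 // exprn_gt0 //.
Qed.

Let V_ge q : H q -> m * (q.1 ^+ 2 + q.2 ^+ 2) <= V q.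
Proof.
move=> wq; have [i Diq] := D_cover wq; rewrite (V_piece wq Diq).
have m1 : m <= 1 by rewrite !ge_min lexx.
have mK : m <= K1 by rewrite !ge_min lexx orbT.
have mk : m <= k / (1 + mu ^+ 2) by rewrite !ge_min lexx orbT.
have s1 := sqr_ge0 q.1; have s2 := sqr_ge0 q.2.
have a1 := ler_wpM2r s1 mK; have a2 := ler_wpM2r s2 m1.
have a3 := ler_wpM2r s1 (ltW K12).
case: i Diq => [[]|] /DE [q1 q2]; rewrite /coef.
- by rewrite /quad /upper_left /=; lra.
- have : 0 <= b * (q.1 * q.2) by rewrite !mulr_ge0 // ltW.
  by rewrite /quad /upper_right /=; lra.
rewrite lower_rightE.
have h1 : q.1 ^+ 2 <= (q.1 + c * w q) ^+ 2.
  have cw : 0 <= c * w q by apply: mulr_ge0 => //; exact: ltW.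
  by rewrite lerXn2r ?nnegrE ?lerDl // addr_ge0.
have h2 : q.2 ^+ 2 <= mu ^+ 2 * q.1 ^+ 2.
  rewrite -exprMn -[leLHS]sqrrN lerXn2r ?nnegrE ?oppr_ge0 //.
    by rewrite mulr_ge0 // ltW.
  by move: wq; rewrite /H /=; lra.
have mu1 : 0 < 1 + mu ^+ 2 by rewrite addr_gt0 // exprn_gt0.
rewrite ler_pdivlMr // in mk.
have h3 : m * (q.1 ^+ 2 + q.2 ^+ 2) <= m * ((1 + mu ^+ 2) * q.1 ^+ 2).
  by rewrite ler_pM2l //; lra.
have h4 := ler_wpM2r s1 mk.
have h5 : k * q.1 ^+ 2 <= k * (q.1 + c * w q) ^+ 2 by rewrite ler_pM2l.
lra.
Qed.

Lemma GUAS_invariant_slope : GUAS (Sigma_w K1 K2 B1 B2).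
Proof.
pose C := quad_norm upper_left + quad_norm upper_right + quad_norm lower_right + 1.
have C_gt0 : 0 < C by rewrite /C ltr_wpDl // !addr_ge0 // quad_norm_ge0.
have leC i : quad_norm (coef i) <= C.
  have := quad_norm_ge0 upper_left; have := quad_norm_ge0 upper_right.
  have := quad_norm_ge0 lower_right.
  by case: i => [[]|]; rewrite /coef /C; lra.
have mu2 : 0 < mu ^+ 2 by rewrite exprn_gt0.
pose k1 := 2 * b * mu ^+ 2 / (mu ^+ 2 + K2).
pose k2 := Num.min (2 * b / (2 + b)) (2 * b * K1 / (2 * K1 + b)).
pose k3 := Num.min (2 * mu) (2 / c).
pose kap := Num.min k1 (Num.min k2 k3).
have kap_gt0 : 0 < kap.
  by rewrite !lt_min !divr_gt0 ?addr_gt0 ?mulr_gt0.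
have le1 : kap <= k1 by rewrite ge_min lexx.
have le2 : kap <= 2 * b / (2 + b) by rewrite !ge_min lexx !orbT.
have le3 : kap <= 2 * b * K1 / (2 * K1 + b) by rewrite !ge_min lexx !orbT.
have le4 : kap <= 2 * mu by rewrite !ge_min lexx !orbT.
have le5 : kap <= 2 / c by rewrite !ge_min lexx !orbT.
rewrite ler_pdivlMr ?addr_gt0 ?mulr_gt0 // in le1.
rewrite ler_pdivlMr ?addr_gt0 ?mulr_gt0 // in le2.
rewrite ler_pdivlMr ?addr_gt0 ?mulr_gt0 // in le3.
rewrite ler_pdivlMr // in le5.
have V_le q : H q -> `|V q| <= C * (q.1 ^+ 2 + q.2 ^+ 2).
  move=> wq; have [i Diq] := D_cover wq; rewrite (V_piece wq Diq).
  by apply: (le_trans (quad_le _ _)); rewrite ler_wpM2r // addr_ge0 // sqr_ge0.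
apply: (@GUAS_energy R _ m C kap) => //.
have main t0 z : Sigma_w K1 K2 B1 B2 t0 z -> H (pt (z t0)) -> forall t, t0 <= t ->
     m * (z1 (z t) ^+ 2 + z2 (z t) ^+ 2) <=
     expR (- kap * (t - t0)) * (C * (z1 (z t0) ^+ 2 + z2 (z t0) ^+ 2)).
  move=> Sz Hz t tt.
  have Ht := halfplane_invariant K1_gt0 K2_gt0 B1_gt0 B2_gt0 slope Sz Hz.
  apply: (le_trans (V_ge (Ht t tt))).
  have := @lyapunov_decay R K1 K2 B1 B2 t0 C kap H (option bool) D
    (fun i => quad (coef i)) (fun i => quad_grad (coef i)) V z Sz Ht (ltW C_gt0)
    D_closed D_cover V_piece V_le.
  move=> h; apply: (le_trans (h _ t tt)).
    move=> i q Hq Diq q0; have [g1 g2] := quad_grad_le (coef i) q.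
    have n0 : 0 <= `|q.1| + `|q.2| by rewrite addr_ge0.
    split.
    - exact: has_grad_quad.
    - by apply: (le_trans g1); rewrite ler_wpM2r.
    - by apply: (le_trans g2); rewrite ler_wpM2r.
    rewrite (V_piece Hq Diq) (_ : (vfield K1 K2 B1 B2 q).1 = q.2) // -/(F q).
    case: i Diq {g1 g2} => [[]|] /DE [q1 q2]; rewrite /coef.
    - by apply: upper_left_decay => //; exact: ltW.
    - by apply: upper_right_decay => //; exact: ltW.
    - exact: lower_right_decay.
  rewrite ler_wpM2l ?expR_ge0 //.
  by apply: le_trans (V_le _ Hz); exact: ler_norm.
move=> t0 z Sz t tt.
have [wz|wz] := leP 0 (w (pt (z t0))); first exact: main.
have N1 (v : 'cV[R]_2) : z1 (- v) = - z1 v by rewrite /z1 !mxE.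
have N2 (v : 'cV[R]_2) : z2 (- v) = - z2 v by rewrite /z2 !mxE.
have := main t0 _ (Sigma_wN Sz) _ t tt.
rewrite !N1 !N2 !sqrrN; apply.
by move: wz; rewrite /H /= N1 N2; lra.
Qed.

End invariant_halfplane_decay.

(** * Crossing times *)

Section sector.
Context {R : realType}.
Implicit Types (p : R * R).

(* With [s = (-1) ^+ i], the closure of the region [S_i], and the quadratic form
   that decays like [expR (- B * t)] along [A_i]. *)
Definition in_sector (s dK dB : R) p : Prop :=
  0 <= s * (p.2 * (dK * p.1 + dB * p.2)).

Definition qform (K B : R) p : R := p.2 ^+ 2 + B * (p.1 * p.2) + K * p.1 ^+ 2.

(* [tau] measures the time spent in the sector, whose crossing takes time [T]. *)
Definition sector_time (s K B dK dB T : R) (tau : R * R -> R) : Prop :=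
  [/\ forall p, in_sector s dK dB p -> p != 0 ->
        has_grad tau p (p.2 / qform K B p, - p.1 / qform K B p),
      exists M : R, forall p, in_sector s dK dB p -> p != 0 -> `|tau p| <= M,
      exists2 m : R, 0 < m & forall p, in_sector s dK dB p ->
        m * (p.1 ^+ 2 + p.2 ^+ 2) <= qform K B p,
      forall p, p != 0 -> p.2 = 0 -> tau p = 0 &
      forall p, p != 0 -> dK * p.1 + dB * p.2 = 0 -> tau p = s * T].

Lemma pair_neq0 p : (p != 0) = (p.1 != 0) || (p.2 != 0).
Proof. by case: p => a b; rewrite -negb_and. Qed.

Lemma sumsqr_gt0 p : p != 0 -> 0 < p.1 ^+ 2 + p.2 ^+ 2.
Proof.
by rewrite pair_neq0 => /orP[h|h]; [rewrite ltr_pwDl|rewrite ltr_wpDl];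
  rewrite ?sqr_ge0 // lt_neqAle sqr_ge0 andbT eq_sym expf_neq0.
Qed.

(** The edges of this double cone are spanned by [(- s, 0)] on the axis and [(dB, - dK)] on the
    switching line. In these coordinates the form defining the sector is [dK ^+ 2 * (a * b)], so [a]
    and [b] have the same sign. *)
Lemma sector_cone (s dK dB : R) p : s ^+ 2 = 1 -> dK < 0 -> in_sector s dK dB p ->
  exists a b : R, [/\ p = (- s * a + dB * b, - dK * b) &
    (0 <= a /\ 0 <= b) \/ (a <= 0 /\ b <= 0)].
Proof.
move=> s2 dK0; rewrite /in_sector => hp; have dKn : dK != 0 by rewrite lt_eqF.
pose b := - p.2 / dK; pose a := - s * (p.1 + dB * p.2 / dK).
exists a, b; split.
  apply/eqP; rewrite -pair_eqE /= /a /b; apply/andP; split; apply/eqP.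
    have -> : - s * (- s * (p.1 + dB * p.2 / dK)) = s ^+ 2 * (p.1 + dB * p.2 / dK).
      by ring.
    by rewrite s2; field.
  by field.
have ab : 0 <= a * b.
  rewrite (_ : a * b = s * (p.2 * (dK * p.1 + dB * p.2)) / dK ^+ 2).
    by rewrite mulr_ge0 // invr_ge0 sqr_ge0.
  by rewrite /a /b; field.
have [a0|a0] := ltP 0 a; first by left; split; [exact: ltW|rewrite -(pmulr_rge0 _ a0)].
have [a1|a1] := ltP a 0; first by right; split => //; rewrite -(nmulr_rge0 _ a1).
have a00 : a = 0 by apply/eqP; rewrite eq_le a0 a1.
by have [b0|b0] := leP 0 b; [left|right; rewrite (ltW b0)].
Qed.

(** Applied to two linear forms on the cone, this places their quotient at any nonzero point between
    its values on the two edges. *)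
Lemma mediant (x1 x2 y1 y2 a b : R) : 0 < y1 -> 0 < y2 ->
  (0 <= a /\ 0 <= b) \/ (a <= 0 /\ b <= 0) -> (a != 0) || (b != 0) ->
  [/\ a * y1 + b * y2 != 0,
      Num.min (x1 / y1) (x2 / y2) <= (a * x1 + b * x2) / (a * y1 + b * y2) &
      (a * x1 + b * x2) / (a * y1 + b * y2) <= Num.max (x1 / y1) (x2 / y2)].
Proof.
wlog pos : a b / 0 <= a /\ 0 <= b.
  move=> wlg y10 y20 [h|[a0 b0]] ab; first by apply: wlg => //; left.
  have pos' : 0 <= - a /\ 0 <= - b by rewrite !oppr_ge0.
  have ab' : (- a != 0) || (- b != 0) by rewrite !oppr_eq0.
  have [h1 h2 h3] := wlg _ _ pos' y10 y20 (or_introl pos') ab'.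
  move: h1 h2 h3.
  have -> : - a * y1 + - b * y2 = - (a * y1 + b * y2) by ring.
  have -> : - a * x1 + - b * x2 = - (a * x1 + b * x2) by ring.
  by rewrite oppr_eq0 invrN mulrNN.
move=> y10 y20 _ ab; have [a0 b0] := pos.
have y0 : 0 < a * y1 + b * y2.
  move: ab; rewrite !neq_lt !ltNge a0 b0 /= -!ltNge => /orP[h|h].
    by rewrite ltr_pwDl ?mulr_gt0 // mulr_ge0 // ltW.
  by rewrite ltr_wpDl ?mulr_gt0 // mulr_ge0 // ltW.
split; first by rewrite gt_eqF.
- set m := Num.min _ _.
  have m1 : m * y1 <= x1 by rewrite -ler_pdivlMr // ge_min lexx.
  have m2 : m * y2 <= x2 by rewrite -ler_pdivlMr // ge_min lexx orbT.
  rewrite ler_pdivlMr //.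
  have := ler_wpM2l a0 m1; have := ler_wpM2l b0 m2; lra.
- set m := Num.max _ _.
  have m1 : x1 <= m * y1 by rewrite -ler_pdivrMr // le_max lexx.
  have m2 : x2 <= m * y2 by rewrite -ler_pdivrMr // le_max lexx orbT.
  rewrite ler_pdivrMr //.
  have := ler_wpM2l a0 m1; have := ler_wpM2l b0 m2; lra.
Qed.

(** The gradient of a quotient [l1 / l2] of linear forms is [(a1 * b2 - b1 * a2) / l2 ^+ 2] times
    [(p.2, - p.1)]; the last hypothesis says that [h] rescales it to [r^-1] times that vector. *)
Lemma has_grad_ratio (h : R -> R) (a1 b1 a2 b2 dh r : R) p :
  a2 * p.1 + b2 * p.2 != 0 -> r != 0 ->
  is_derive ((a1 * p.1 + b1 * p.2) / (a2 * p.1 + b2 * p.2)) 1 h dh ->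
  dh * (a1 * b2 - b1 * a2) * r = (a2 * p.1 + b2 * p.2) ^+ 2 ->
  has_grad (fun q => h ((a1 * q.1 + b1 * q.2) / (a2 * q.1 + b2 * q.2))) p
    (p.2 / r, - p.1 / r).
Proof.
move=> l0 r0 Dh hr.
have Dinv : is_derive (a2 * p.1 + b2 * p.2) 1 (@GRing.inv R)
    (- (a2 * p.1 + b2 * p.2) ^- 2).
  have := @is_deriveV R id (a2 * p.1 + b2 * p.2) 1 1 l0 (is_derive_id _ _).
  by rewrite /GRing.scale /= mulr1; exact.
have := has_grad_comp (has_gradM (has_grad_linear a1 b1 p)
  (has_grad_comp (has_grad_linear a2 b2 p) Dinv)) Dh.
move=> hg; apply: (has_grad_eq hg) => //=.
  apply: (mulIf r0); rewrite divfK //.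
  apply: (mulIf (expf_neq0 2 l0)).
  rewrite -[in RHS]hr; field.
  exact: l0.
apply: (mulIf r0); rewrite divfK //.
apply: (mulIf (expf_neq0 2 l0)).
rewrite -[in RHS]hr; field.
exact: l0.
Qed.

(* Every projective coordinate [l1 / l2] of the sector, suitably
   reparametrized by [h], is a time function. *)
Lemma sector_time_ratio (s K B dK dB a1 b1 a2 b2 : R) (h dh : R -> R)
    (dom : R -> Prop) (re := a1 / a2)
    (rv := (a1 * dB - b1 * dK) / (a2 * dB - b2 * dK)) :
  s ^+ 2 = 1 -> dK < 0 ->
  0 < - s * a2 -> 0 < a2 * dB - b2 * dK ->
  dom re -> dom rv -> (forall x y z, dom x -> dom z -> x <= y -> y <= z -> dom y) ->
  (forall x y, dom x -> dom y -> x <= y -> h x <= h y) ->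
  (forall x, dom x -> is_derive x 1 h (dh x)) ->
  (forall p, a2 * p.1 + b2 * p.2 != 0 ->
     dom ((a1 * p.1 + b1 * p.2) / (a2 * p.1 + b2 * p.2)) ->
     dh ((a1 * p.1 + b1 * p.2) / (a2 * p.1 + b2 * p.2)) * (a1 * b2 - b1 * a2) *
     qform K B p = (a2 * p.1 + b2 * p.2) ^+ 2) ->
  (exists2 m : R, 0 < m & forall p, in_sector s dK dB p ->
        m * (p.1 ^+ 2 + p.2 ^+ 2) <= qform K B p) ->
  sector_time s K B dK dB (s * (h rv - h re))
    (fun p => h ((a1 * p.1 + b1 * p.2) / (a2 * p.1 + b2 * p.2)) - h re).
Proof.
move=> s2 dK0 l2e l2v dome domv convex mono Dh hP [m m0 hm].
have a20 : a2 != 0 by apply: contraTneq l2e => ->; rewrite mulr0 ltxx.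
have s0 : s != 0 by apply: contra_eq_neq s2 => ->; rewrite expr0n eq_sym oner_eq0.
have coord p : in_sector s dK dB p -> p != 0 ->
    [/\ a2 * p.1 + b2 * p.2 != 0,
     Num.min re rv <= (a1 * p.1 + b1 * p.2) / (a2 * p.1 + b2 * p.2) &
     (a1 * p.1 + b1 * p.2) / (a2 * p.1 + b2 * p.2) <= Num.max re rv].
  move=> /(sector_cone s2 dK0) [a [b [-> sgn]]] p0.
  have ab : (a != 0) || (b != 0).
    apply: contraNT p0; rewrite negb_or !negbK => /andP[/eqP -> /eqP ->].
    by rewrite !mulr0 addr0.
  have := mediant (- s * a1) (a1 * dB - b1 * dK) l2e l2v sgn ab.
  rewrite /= (_ : - s * a1 / (- s * a2) = re); last first.
    by rewrite /re; field; rewrite s0 a20.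
  rewrite (_ : a * (- s * a2) + b * (a2 * dB - b2 * dK) =
    a2 * (- s * a + dB * b) + b2 * (- dK * b)); last by ring.
  rewrite (_ : a * (- s * a1) + b * (a1 * dB - b1 * dK) =
    a1 * (- s * a + dB * b) + b1 * (- dK * b)); last by ring.
  exact.
have domc x : Num.min re rv <= x -> x <= Num.max re rv -> dom x.
  move=> h1 h2; apply: (convex (Num.min re rv) _ (Num.max re rv)) => //.
    by rewrite minEle; case: ifP.
  by rewrite maxEle; case: ifP.
have Dh' x : dom x -> is_derive x 1 (fun y => h y - h re) (dh x).
  move=> /Dh Dx; have := @is_deriveB _ _ _ h (cst (h re)) x 1 _ _ Dx (is_derive_cst _ _ _).
  by rewrite subr0.
split.
- move=> p Sp p0; have [l0 c1 c2] := coord p Sp p0.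
  have r0 : qform K B p != 0.
    rewrite gt_eqF // (lt_le_trans _ (hm p Sp)) // mulr_gt0 //; exact: sumsqr_gt0.
  apply: (@has_grad_ratio (fun y => h y - h re) _ _ _ _ _ _ _ l0 r0 (Dh' _ (domc _ c1 c2))).
  by apply: hP => //; exact: domc.
- exists (`|h rv - h re|) => p Sp p0; have [_ c1 c2] := coord p Sp p0.
  have d := domc _ c1 c2.
  move: c1 c2; rewrite minEle maxEle; case: ifP => [le1|/negbT]; [|rewrite -ltNge => lt1] => c1 c2.
    have h1 := mono _ _ dome d c1; have h2 := mono _ _ d domv c2.
    rewrite !ger0_norm ?subr_ge0 //; first by rewrite lerD2r.
    exact: le_trans h2.
  have h1 := mono _ _ domv d c1; have h2 := mono _ _ d dome c2.
  rewrite !ler0_norm ?subr_le0 //; first by rewrite lerN2 lerD2r.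
  exact: le_trans h2.
- by exists m.
- move=> p; rewrite pair_neq0 => p0 p2; rewrite p2 eqxx orbF in p0.
  by rewrite p2 !mulr0 !addr0 -mulf_div divff // mulr1 subrr.
- move=> p p0 hv.
  have p1E : p.1 = - dB / dK * p.2.
    have e : dK * p.1 = - dB * p.2 by lra.
    by rewrite -mulrA mulrCA -e mulKf // lt_eqF.
  have p20 : p.2 != 0.
    by apply: contraTneq p0 => e; rewrite pair_neq0 p1E e mulr0 eqxx.
  rewrite mulrA -expr2 s2 mul1r; congr (h _ - _).
  have dKn : dK != 0 by rewrite lt_eqF.
  have nE a b : a * (- dB / dK * p.2) + b * p.2 = - (p.2 / dK) * (a * dB - b * dK).
    by field.
  by rewrite /rv p1E !nE -mulf_div divff ?mul1r // oppr_eq0 mulf_neq0 // invr_eq0.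
Qed.

End sector.

(** * Crossing times for real, double and complex eigenvalues *)

Section sector_cases.
Context {R : realType}.
Variables (s K B dK dB : R).
Hypotheses (s2 : s ^+ 2 = 1) (K_gt0 : 0 < K) (B_gt0 : 0 < B) (dK_lt0 : dK < 0).

(* [qform K B] at the point [(dB, - dK)] of the switching line. *)
Definition qform_line : R := dK ^+ 2 - B * dK * dB + K * dB ^+ 2.

(** The logarithm of the ratio of the Euclidean norms at the exit and at the entry of a crossing.
    The form [qform] loses the factor [expR (- B * T)], and its values at unit vectors of the axis
    and of the switching line are [K] and [qform_line / (dK ^+ 2 + dB ^+ 2)]. The sign [s] reflects
    that [S_2] is entered through the axis and [S_1] through the switching line. *)
Definition log_ratio (T : R) : R :=
  s / 2 * ln (K * (dK ^+ 2 + dB ^+ 2) / qform_line) - B / 2 * T.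

(** In the coordinates of [sector_cone] the form is [K * a ^+ 2 + s * Q * (a * b) + D * b ^+ 2] with
    [Q = B * dK - 2 * K * dB], and the mixed term is nonnegative. *)
Lemma qform_lower_cone : 0 <= s * (B * dK - 2 * K * dB) -> 0 < qform_line ->
  exists2 m : R, 0 < m & forall p, in_sector s dK dB p ->
    m * (p.1 ^+ 2 + p.2 ^+ 2) <= qform K B p.
Proof.
rewrite /qform_line => hQ hD; set D := _ + _ in hD.
pose A := 2 * (1 + dK ^+ 2 + dB ^+ 2).
have A0 : 0 < A.
  by rewrite mulr_gt0 // -addrA ltr_pwDl // addr_ge0 // sqr_ge0.
pose m := Num.min K D / A.
exists m; first by rewrite divr_gt0 // lt_min K_gt0.
move=> p /(sector_cone s2 dK_lt0) [a [b [-> sgn]]].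
have ab : 0 <= a * b.
  by case: sgn => -[a0 b0]; [rewrite mulr_ge0|rewrite mulr_le0].
have rE : qform K B (- s * a + dB * b, - dK * b) =
    K * a ^+ 2 + s * (B * dK - 2 * K * dB) * (a * b) + D * b ^+ 2.
  rewrite /qform /= (_ : K * (- s * a + dB * b) ^+ 2 =
    s ^+ 2 * K * a ^+ 2 - 2 * s * K * dB * (a * b) + K * dB ^+ 2 * b ^+ 2); last by ring.
  by rewrite s2 /D; ring.
have sE : (- s * a + dB * b) ^+ 2 = a ^+ 2 - 2 * s * dB * (a * b) + dB ^+ 2 * b ^+ 2.
  by rewrite -[in RHS](mul1r (a ^+ 2)) -{1}s2; ring.
have a2 := sqr_ge0 a; have b2 := sqr_ge0 b.
rewrite rE /= sE.
have h1 : 0 <= s * (B * dK - 2 * K * dB) * (a * b) by rewrite mulr_ge0.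
have mA : m * A = Num.min K D by rewrite /m divfK // gt_eqF.
have mK : m * A <= K by rewrite mA ge_min lexx.
have mD : m * A <= D by rewrite mA ge_min lexx orbT.
have m0 : 0 <= m by rewrite divr_ge0 ?(ltW A0) // le_min !ltW.
have h2 : a ^+ 2 - 2 * s * dB * (a * b) + dB ^+ 2 * b ^+ 2 + (- dK * b) ^+ 2 <=
    A * (a ^+ 2 + b ^+ 2).
  have e : 0 <= s ^+ 2 * a ^+ 2 + 2 * s * dB * (a * b) + dB ^+ 2 * b ^+ 2.
    by have := sqr_ge0 (s * a + dB * b); lra.
  have f1 : 0 <= dK ^+ 2 * b ^+ 2 by rewrite mulr_ge0 ?sqr_ge0.
  have f2 : 0 <= dK ^+ 2 * a ^+ 2 by rewrite mulr_ge0 ?sqr_ge0.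
  have f3 : 0 <= dB ^+ 2 * a ^+ 2 by rewrite mulr_ge0 ?sqr_ge0.
  by rewrite s2 in e; rewrite /A; lra.
have h3 := ler_wpM2l m0 h2.
have h4 := ler_wpM2r a2 mK; have h5 := ler_wpM2r b2 mD.
lra.
Qed.

Lemma qform_lower_def : B ^+ 2 < 4 * K ->
  exists2 m : R, 0 < m & forall p, m * (p.1 ^+ 2 + p.2 ^+ 2) <= qform K B p.
Proof.
move=> disc; pose w := K - B ^+ 2 / 4.
have w0 : 0 < w by rewrite /w; lra.
pose A := 2 + (B ^+ 2 / 2 + 1) / w.
have A0 : 0 < A by rewrite ltr_wpDr // divr_ge0 ?(ltW w0) // addr_ge0 // divr_ge0 // sqr_ge0.
exists A^-1; first by rewrite invr_gt0.
move=> p; rewrite mulrC ler_pdivrMr //.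
have -> : qform K B p = (p.2 + B / 2 * p.1) ^+ 2 + w * p.1 ^+ 2.
  by rewrite /qform /w; field.
set y := p.2 + B / 2 * p.1.
have p2E : p.2 = y - B / 2 * p.1 by rewrite /y; ring.
rewrite p2E /A.
have -> : (y ^+ 2 + w * p.1 ^+ 2) * (2 + (B ^+ 2 / 2 + 1) / w) =
  2 * y ^+ 2 + 2 * w * p.1 ^+ 2 + y ^+ 2 * ((B ^+ 2 / 2 + 1) / w) +
  (B ^+ 2 / 2 + 1) * p.1 ^+ 2 by field; rewrite gt_eqF.
have h1 : 0 <= y ^+ 2 * ((B ^+ 2 / 2 + 1) / w).
  by rewrite mulr_ge0 ?sqr_ge0 // divr_ge0 ?(ltW w0) // addr_ge0 // divr_ge0 // sqr_ge0.
have h2 := sqr_ge0 (y + B / 2 * p.1).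
have h3 := sqr_ge0 p.1.
have h4 : 0 <= w * p.1 ^+ 2 by rewrite mulr_ge0 // ltW.
lra.
Qed.

End sector_cases.

Section sector_overdamped.
Context {R : realType}.
Variables (i : nat) (K B dK dB : R).
Let s : R := (-1) ^+ i.
Hypotheses (K_gt0 : 0 < K) (B_gt0 : 0 < B) (dK_lt0 : dK < 0).
Let la := lambda_a K B.
Let lb := lambda_b K B.

Let s2 : s ^+ 2 = 1. Proof. exact: sqrr_sign. Qed.

(** The linear forms [la * p.1 - p.2] and [lb * p.1 - p.2] factor [qform], and along [A_i] they
    evolve like [expR (lb * t)] and [expR (la * t)]. With both eigenvectors outside the sector their
    quotient is positive there, and its logarithm divided by [lb - la] is time. *)
Lemma sector_overdamped : 4 * K < B ^+ 2 ->
  0 < s * (dK + la * dB) -> 0 < s * (dK + lb * dB) ->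
  exists T tau, [/\ sector_time s K B dK dB T tau, 0 < T &
    Lambda i K B dK dB = expR (log_ratio s K B dK dB T)].
Proof.
move=> disc sa sb; have K0 := K_gt0; have B0 := B_gt0; have dK0 := dK_lt0.
pose r := Num.sqrt (B ^+ 2 - 4 * K).
have r0 : 0 < r by rewrite sqrtr_gt0; lra.
have r2 : r ^+ 2 = B ^+ 2 - 4 * K by rewrite sqr_sqrtr //; lra.
have laE : la = (- B - r) / 2 by [].
have lbE : lb = (- B + r) / 2 by [].
have rB : r < B.
  have : r ^+ 2 < B ^+ 2 by rewrite r2; lra.
  by rewrite ltr_pXn2r ?nnegrE ?(ltW r0) ?(ltW B_gt0).
have la0 : la < 0 by rewrite laE; lra.
have lb0 : lb < 0 by rewrite lbE; lra.
have lab : la < lb by rewrite laE lbE; lra.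
have sumE : la + lb = - B by rewrite laE lbE; field.
have prodE : la * lb = K.
  rewrite laE lbE (_ : _ * _ = (B ^+ 2 - r ^+ 2) / 4); last by field.
  by rewrite r2; field.
have DE : qform_line K B dK dB = (dK + la * dB) * (dK + lb * dB).
  rewrite /qform_line -prodE (_ : B = - (la + lb)); last by rewrite sumE opprK.
  by ring.
have D0 : 0 < qform_line K B dK dB.
  rewrite DE -[ltRHS]mul1r -s2 (_ : _ * _ = (s * (dK + la * dB)) * (s * (dK + lb * dB))).
    exact: mulr_gt0.
  by ring.
have Q0 : 0 <= s * (B * dK - 2 * K * dB).
  rewrite (_ : _ * _ = - la * (s * (dK + lb * dB)) + - lb * (s * (dK + la * dB))).
    by rewrite addr_ge0 // mulr_ge0 ?oppr_ge0 // ltW.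
  by rewrite -prodE (_ : B = - (la + lb)); [ring|rewrite sumE opprK].
have dl : 0 < lb - la by rewrite subr_gt0.
have sN0 : s != 0 by rewrite signr_eq0.
have hm := qform_lower_cone s2 K_gt0 dK_lt0 Q0 D0.
have := @sector_time_ratio R s K B dK dB (s * la) (- s) (s * lb) (- s)
  (fun x => ln x / (lb - la)) (fun x => x^-1 / (lb - la)) (fun x => 0 < x) s2 dK_lt0.
have e1 : s * la / (s * lb) = la / lb by rewrite -mulf_div divff ?mul1r.
have e2 : (s * la * dB - - s * dK) / (s * lb * dB - - s * dK) =
    (s * (dK + la * dB)) / (s * (dK + lb * dB)) by congr (_ / _); ring.
have r1 : 0 < la / lb by rewrite nmulr_rgt0 // invr_lt0.
have r3 : 0 < s * (dK + la * dB) / (s * (dK + lb * dB)) by exact: divr_gt0.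
rewrite e1 e2 => /(_ _ _ r1 r3) H.
set T := s * (ln _ / _ - ln _ / _) in H.
have {}H : sector_time s K B dK dB T
  (fun p => ln ((s * la * p.1 + - s * p.2) / (s * lb * p.1 + - s * p.2)) / (lb - la) -
            ln (la / lb) / (lb - la)).
  apply: H => //.
  - by rewrite mulNr mulrA -expr2 s2 mul1r oppr_gt0.
  - by rewrite (_ : _ - _ = s * (dK + lb * dB)) //; ring.
  - by move=> x y z x0 _ xy _; exact: lt_le_trans xy.
  - by move=> x y x0 y0 xy; rewrite ler_pM2r ?invr_gt0 // ler_ln.
  - move=> x x0.
    have := @is_deriveZ _ _ _ (@ln R) (lb - la)^-1 x 1 _ (is_derive1_ln x0).
    rewrite /GRing.scale /= mulrC.
    by rewrite (_ : (fun x => ln x / (lb - la)) = (lb - la)^-1 \*: (@ln R)) // funeqE => y;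
      rewrite mulrC.
  - move=> p l2 ; set l1 := s * la * p.1 + - s * p.2; set l2' := s * lb * p.1 + - s * p.2 in l2 *.
    move=> l12.
    have l1n : l1 != 0 by apply: contraTneq l12 => ->; rewrite mul0r ltxx.
    have -> : qform K B p = l1 * l2'.
      rewrite /qform -prodE (_ : B = - (la + lb)); last by rewrite sumE opprK.
      rewrite (_ : l1 * l2' = s ^+ 2 * ((la * p.1 - p.2) * (lb * p.1 - p.2))).
        by rewrite s2; ring.
      by rewrite /l1 /l2'; ring.
    rewrite (_ : s * la * - s - - s * (s * lb) = s ^+ 2 * (lb - la)); last by ring.
    by rewrite s2; field; rewrite l2 l1n gt_eqF.
have dlb : dK + lb * dB != 0 by apply: contraTneq sb => ->; rewrite mulr0 ltxx.
(* Since [K = la * lb], these are the absolute values of the two numerators in [Lambda]. Their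
   difference has the sign of [s], whence [0 < T]. *)
have X0 : 0 < - lb * (s * (dK + la * dB)) by rewrite mulr_gt0 // oppr_gt0.
have Y0 : 0 < - la * (s * (dK + lb * dB)) by rewrite mulr_gt0 // oppr_gt0.
set X := - lb * _ in X0; set Y := - la * _ in Y0.
have TE : T = s * ((ln X - ln Y) / (lb - la)).
  rewrite /T; congr (s * _); rewrite -mulrBl; congr (_ / _).
  rewrite -!ln_div ?posrE //; congr ln; rewrite /X /Y; field.
  by rewrite dlb sN0 (lt_eqF la0) (lt_eqF lb0).
have XYs : X - Y = - s * dK * (lb - la) by rewrite /X /Y; ring.
exists T; eexists; split; first exact: H.
  rewrite TE mulrA divr_gt0 //.
  have [s1|s1] : s = 1 \/ s = -1.
    by move/eqP: s2; rewrite sqrf_eq1 => /orP[/eqP|/eqP]; [left|right].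
    rewrite s1 mul1r subr_gt0 ltr_ln ?posrE // -subr_gt0 XYs s1.
    by rewrite mulN1r mulr_gt0 // oppr_gt0.
  rewrite s1 mulN1r oppr_gt0 subr_lt0 ltr_ln ?posrE // -subr_lt0 XYs s1.
  by rewrite opprK mul1r nmulr_rlt0.
have L2 : 0 < dK ^+ 2 + dB ^+ 2.
  by rewrite ltr_pwDl ?sqr_ge0 // exprn_even_gt0 //= lt_eqF.
rewrite /Lambda ltNge (ltW disc) /= gt_eqF // -/s -/la -/lb.
set L := Num.sqrt _.
have L0 : 0 < L by rewrite sqrtr_gt0.
have KL0 : 0 < K * L by rewrite mulr_gt0.
have sn : `|s| = 1 by rewrite normr_sign.
have XE : `|(dK * lb + K * dB) / (K * L)| = X / (K * L).
  rewrite normrM (_ : dK * lb + K * dB = - s * X).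
    by rewrite normrM normrN sn mul1r (gtr0_norm X0) gtr0_norm // invr_gt0.
  rewrite (_ : - s * X = s ^+ 2 * lb * (dK + la * dB)); last by rewrite /X; ring.
  by rewrite s2 -prodE; ring.
have YE : `|(dK * la + K * dB) / (K * L)| = Y / (K * L).
  rewrite normrM (_ : dK * la + K * dB = - s * Y).
    by rewrite normrM normrN sn mul1r (gtr0_norm Y0) gtr0_norm // invr_gt0.
  rewrite (_ : - s * Y = s ^+ 2 * la * (dK + lb * dB)); last by rewrite /Y; ring.
  by rewrite s2 -prodE; ring.
have lnXY : ln (qform_line K B dK dB) = ln X + ln Y - ln K.
  have XY0 := mulr_gt0 X0 Y0.
  rewrite -lnM ?posrE // -ln_div ?posrE //; congr ln.
  rewrite (_ : X * Y = s ^+ 2 * ((la * lb) * qform_line K B dK dB)).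
    by rewrite s2 prodE mul1r mulrC mulKf // gt_eqF.
  by rewrite DE /X /Y; ring.
have lnL : ln (dK ^+ 2 + dB ^+ 2) = 2 * ln L.
  rewrite -[X in ln X](sqr_sqrtr (ltW L2)) lnXn //; first by rewrite mulr_natl.
move: X Y X0 Y0 XE YE lnXY TE {XYs} => X Y X0 Y0 XE YE lnXY TE.
rewrite XE YE /powR !gt_eqF ?(divr_gt0 X0 KL0) ?(divr_gt0 Y0 KL0) // -expRD; congr expR.
have KL2 := mulr_gt0 K0 L2.
rewrite /log_ratio !ln_div ?posrE // !lnM ?posrE // lnXY lnL TE.
rewrite (_ : B = - (la + lb)); last by rewrite sumE opprK.
field.
by rewrite subr_eq0 subr_eq0 (gt_eqF lab) (lt_eqF lab).
Qed.

End sector_overdamped.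

(** Now [qform] is the square of [p.2 + B / 2 * p.1], a linear form that evolves like
    [expR (- B / 2 * t)]. The quotient of [p.1] by it increases at unit speed, so it is itself a
    time function. *)
Lemma sector_critical (R : realType) (i : nat) (K B dK dB : R)
    (s := (-1) ^+ i : R) :
  0 < K -> 0 < B -> dK < 0 -> B ^+ 2 = 4 * K -> 0 < s * (2 * dK - B * dB) ->
  exists T tau, [/\ sector_time s K B dK dB T tau, 0 < T &
    Lambda i K B dK dB = expR (log_ratio s K B dK dB T)].
Proof.
move=> K0 B0 dK0 disc; set u := 2 * dK - B * dB => su.
have s2 : s ^+ 2 = 1 by exact: sqrr_sign.
have sN0 : s != 0 by rewrite signr_eq0.
have sn : `|s| = 1 by rewrite normr_sign.
have KE : K = B ^+ 2 / 4 by rewrite disc; field.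
have un0 : u != 0 by apply: contraTneq su => ->; rewrite mulr0 ltxx.
have DE : qform_line K B dK dB = u ^+ 2 / 4 by rewrite /qform_line KE /u; field.
have D0 : 0 < qform_line K B dK dB by rewrite DE divr_gt0 // exprn_even_gt0.
have Q0 : 0 <= s * (B * dK - 2 * K * dB).
  rewrite (_ : _ * _ = B / 2 * (s * u)); last by rewrite KE /u; field.
  by rewrite mulr_ge0 ?(ltW su) // divr_ge0 // ltW.
have hm := qform_lower_cone s2 K0 dK0 Q0 D0.
have e1 : - s / - (s * (B / 2)) = 2 / B by field; rewrite sN0 gt_eqF.
have e2 : (- s * dB - 0 * dK) / (- (s * (B / 2)) * dB - - s * dK) = - (2 * dB) / u.
  rewrite (_ : - (s * (B / 2)) * dB - - s * dK = s * u / 2); last by rewrite /u; field.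
  by field; rewrite un0 sN0.
pose T := s * (- (2 * dB) / u - 2 / B).
have H : sector_time s K B dK dB T
  (fun p => (- s * p.1 + 0 * p.2) / (- (s * (B / 2)) * p.1 + - s * p.2) - 2 / B).
  rewrite /T -e1 -e2.
  apply: (@sector_time_ratio R s K B dK dB (- s) 0 (- (s * (B / 2))) (- s)
    id (fun=> 1) (fun=> True)) => //.
  - rewrite [ltRHS](_ : _ = s ^+ 2 * (B / 2)); last by field.
    by rewrite s2 mul1r divr_gt0.
  - rewrite [ltRHS](_ : _ = s * u / 2); last by rewrite /u; field.
    exact: divr_gt0.
  - move=> p _ _; rewrite mul1r mul0r subr0 mulrNN -expr2 s2 mul1r /qform KE.
    rewrite (_ : - (s * (B / 2)) * p.1 + - s * p.2 = - s * (p.2 + B / 2 * p.1)); last by ring.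
    by rewrite exprMn sqrrN s2; field.
have TE : T = - s * (4 * dK) / (B * u).
  have un1 : 2 * dK - B * dB != 0 by exact: un0.
  by rewrite /T /u; field; rewrite un1 gt_eqF.
exists T; eexists; split; first exact: H.
  rewrite TE (_ : _ / _ = (- (4 * dK)) / (B * (s * u))); last first.
    have -> : - (4 * dK) = s ^+ 2 * - (4 * dK) by rewrite s2 mul1r.
    by field; rewrite sN0 un0 gt_eqF.
  apply: divr_gt0; last by apply: mulr_gt0.
  by rewrite oppr_gt0 pmulr_rlt0.
have L2 : 0 < dK ^+ 2 + dB ^+ 2.
  by rewrite ltr_pwDl ?sqr_ge0 // exprn_even_gt0 //= lt_eqF.
rewrite /Lambda disc ltxx eqxx -/s -/u.
set L := Num.sqrt _.
have L0 : 0 < L by rewrite sqrtr_gt0.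
have lnL : ln (dK ^+ 2 + dB ^+ 2) = 2 * ln L.
  by rewrite -[X in ln X](sqr_sqrtr (ltW L2)) lnXn //; rewrite mulr_natl.
have w0 : 0 < s * u by [].
have aE : `|B * L / u| = B * L / (s * u).
  rewrite normrM normfV gtr0_norm ?mulr_gt0 //; congr (_ / _).
  by rewrite -(gtr0_norm su) normrM sn mul1r.
have lnD : ln (qform_line K B dK dB) = 2 * ln (s * u) - ln 4.
  rewrite DE (_ : u ^+ 2 = (s * u) ^+ 2); last by rewrite exprMn s2 mul1r.
  by rewrite ln_div ?posrE ?exprn_gt0 // lnXn // mulr_natl.
have lnK : ln K = 2 * ln B - ln 4.
  by rewrite KE ln_div ?posrE ?exprn_gt0 // lnXn // mulr_natl.
have BL0 : 0 < B * L by rewrite mulr_gt0.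
have KL2 := mulr_gt0 K0 L2.
rewrite aE /powR gt_eqF ?divr_gt0 // -expRD; congr expR.
rewrite /log_ratio TE ln_div ?posrE // [ln (K * _ / _)]ln_div ?posrE //.
rewrite !(lnM (x := B)) ?posrE // (lnM (x := K)) ?posrE // lnL lnD lnK.
by field; rewrite un0 gt_eqF.
Qed.

Lemma atan_slope (R : realType) (K om r l1 l2 : R) : l2 != 0 -> om != 0 ->
  l1 ^+ 2 + l2 ^+ 2 = K * r ->
  om^-1 * (1 + (l1 / l2) ^+ 2)^-1 * (K * om) * r = l2 ^+ 2.
Proof.
move=> l20 om0 e.
have X0 : 1 + (l1 / l2) ^+ 2 != 0 by rewrite gt_eqF // ltr_pwDl // sqr_ge0.
have e' : l1 ^+ 2 + l2 ^+ 2 = l2 ^+ 2 * (1 + (l1 / l2) ^+ 2) by field.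
rewrite (mulrC K) -!mulrA [_ * (om * _)]mulrCA mulKf //.
by rewrite -e e' mulrCA mulVf ?mulr1.
Qed.

Section sector_underdamped.
Context {R : realType}.
Variables (i : nat) (K B dK dB : R).
Let s : R := (-1) ^+ i.
Let om := omega K B.
Let Q := Qc K B dK dB.
Let ph := phi i K B dK dB.

(** On [(0, pi)] the equation determines the angle, also when [Q = 0], so the remainder modulo [pi]
    can be forgotten. The value 0 is excluded because [dK] is nonzero. *)
Lemma phi_spec : B ^+ 2 < 4 * K -> dK < 0 ->
  [/\ 0 < ph, ph < pi & sin ph * (s * Q) = cos ph * (- (2 * om * dK))].
Proof.
move=> disc dK0.
have om0 : 0 < om by rewrite mulr_gt0 ?invr_gt0 // sqrtr_gt0 subr_gt0.
have pi0 := pi_gt0 R.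
rewrite /ph /phi -/Q -/om -/s; case: eqVneq => [->|Q0].
  rewrite sin_pihalf cos_pihalf !mulr0 mul0r; split => //; lra.
set y := s * 2 * om * dK / Q.
have sN0 : s != 0 by rewrite signr_eq0.
have y0 : y != 0.
  rewrite /y mulf_neq0 ?invr_eq0 // mulf_neq0 ?(lt_eqF dK0) //.
  by rewrite mulf_neq0 ?(gt_eqF om0) // mulf_neq0 // pnatr_eq0.
set x := - atan y.
have x1 : - (pi / 2) < x by rewrite /x ltrN2 atan_ltpi2.
have x2 : x < pi / 2 by rewrite /x ltrNl atan_gtNpi2.
have x0 : x != 0.
  rewrite /x oppr_eq0; apply: contra_neq y0 => h.
  by rewrite -[y]atanK h tan0.
have cx : 0 < cos x by apply: cos_gt0_pihalf; rewrite x1 x2.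
have s2 : s ^+ 2 = 1 by exact: sqrr_sign.
have main : sin x * (s * Q) = cos x * (- (2 * om * dK)).
  have : tan x = - y by rewrite /x tanN atanK.
  rewrite /tan => h.
  have -> : sin x = - y * cos x by rewrite -h divfK // gt_eqF.
  rewrite (_ : - y * cos x * (s * Q) = - s ^+ 2 * cos x * (2 * om * dK)).
    by rewrite s2; ring.
  by rewrite /y; field.
have [xneg|xpos|/eqP xz] := ltrgtP x 0; last by rewrite (negbTE x0) in xz.
- have fl : Num.floor (x / pi) = -1.
    apply: floor_def; rewrite addNr /=.
    by rewrite ler_pdivlMr // ltr_pdivrMr // mul0r xneg andbT mulN1r; lra.
  have -> : rmod x pi = x + pi by rewrite /rmod fl mulrN1 opprK.
  by rewrite sinDpi cosDpi !mulNr main; split => //; lra.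
- have fl : Num.floor (x / pi) = 0.
    apply: floor_def; rewrite add0r /=.
    by rewrite divr_ge0 ?(ltW xpos) ?(ltW pi0) //= ltr_pdivrMr // mul1r; lra.
  by have -> : rmod x pi = x; [rewrite /rmod fl mulr0 subr0|split => //; lra].
Qed.

Lemma sector_underdamped : 0 < K -> 0 < B -> dK < 0 -> B ^+ 2 < 4 * K ->
  exists T tau, [/\ sector_time s K B dK dB T tau, 0 < T &
    Lambda i K B dK dB = expR (log_ratio s K B dK dB T)].
Proof.
move=> K0 B0 dK0 disc.
have [ph0 phpi phE] := phi_spec disc dK0.
have om0 : 0 < om by rewrite mulr_gt0 ?invr_gt0 // sqrtr_gt0 subr_gt0.
have omn : om != 0 by rewrite gt_eqF.
have om2 : om ^+ 2 = K - B ^+ 2 / 4.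
  by rewrite /om /omega exprMn sqr_sqrtr ?subr_ge0 1?ltW //; field.
have s2 : s ^+ 2 = 1 by exact: sqrr_sign.
have sN0 : s != 0 by rewrite signr_eq0.
have QE : Q = B * dK - 2 * K * dB by [].
(* Half angles are needed because [ph] ranges over [(0, pi)]: seen from the bisector, the edges lie
   at angles of size [ph / 2 < pi / 2], so one branch of [atan] covers the sector. *)
pose c := cos (ph / 2); pose g := sin (ph / 2).
have h0 : 0 < ph / 2 by rewrite divr_gt0.
have h1 : ph / 2 < pi / 2 by rewrite ltr_pM2r ?invr_gt0.
have hN : - (pi / 2) < ph / 2.
  by apply: lt_trans h0; rewrite oppr_lt0 divr_gt0 // pi_gt0.
have c0 : 0 < c by apply: cos_gt0_pihalf; rewrite hN h1.
have g0 : 0 < g by apply: sin_gt0_pi; rewrite h0 (lt_trans h1) // ltr_pdivrMr // ltr_pMr ?pi_gt0 // ltr1n.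
have cg : c ^+ 2 + g ^+ 2 = 1 by exact: cos2Dsin2.
have ph2 : ph = (ph / 2) *+ 2 by rewrite -mulr_natr divfK.
have cosE : cos ph = c ^+ 2 - g ^+ 2.
  by rewrite ph2 cos_mulr2n -/c -cg mulr2n; ring.
have sinE : sin ph = 2 * (g * c).
  by rewrite ph2 sin_mulr2n -/c -/g mulr2n; ring.
rewrite cosE sinE in phE.
have gc0 : 2 * (g * c) != 0 by rewrite !mulf_neq0 ?pnatr_eq0 // gt_eqF.
(* The vector [(s * Q / 2, - om * dK)] has polar coordinates [r] and [ph]. *)
pose r := - (om * dK) / (2 * (g * c)).
have r0 : 0 < r.
  rewrite divr_gt0 // ?oppr_gt0 ?pmulr_rlt0 //.
  by rewrite !mulr_gt0.
have rS : om * dK = - (r * (2 * (g * c))) by rewrite /r divfK // opprK.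
have rC : s * Q / 2 = r * (c ^+ 2 - g ^+ 2).
  apply: (mulfI gc0).
  rewrite (_ : 2 * (g * c) * (s * Q / 2) = 2 * (g * c) * (s * Q) / 2); last by field.
  rewrite phE (_ : - (2 * om * dK) = - 2 * (om * dK)); last by ring.
  by rewrite rS; field.
pose t := s * g.
have ct : c ^+ 2 + t ^+ 2 = 1 by rewrite /t exprMn s2 mul1r.
(* In coordinates where [A_i] is a similarity, [l1 / l2] is the tangent of the angle
   from the bisector of the sector. *)
pose a1 := s * K * t; pose b1 := s * (c * om + B * t / 2).
pose a2 := - s * K * c; pose b2 := s * (t * om - B * c / 2).
have v2 : a2 * dB - b2 * dK = r * c.
  rewrite (_ : _ - _ = c * (s * Q / 2) - s * t * (om * dK)); last by rewrite /a2 /b2 QE; field.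
  rewrite rC rS (_ : s * t = s ^+ 2 * g); last by rewrite /t; ring.
  rewrite s2 (_ : _ - _ = r * c * (c ^+ 2 + g ^+ 2)); last by ring.
  by rewrite cg mulr1.
have v1 : a1 * dB - b1 * dK = r * t.
  rewrite (_ : _ - _ = - t * (s * Q / 2) - s * c * (om * dK)); last by rewrite /a1 /b1 QE; field.
  rewrite rC rS /t (_ : _ - _ = r * (s * g) * (c ^+ 2 + g ^+ 2)); last by ring.
  by rewrite cg mulr1.
have e1 : a1 / a2 = - (t / c) by rewrite /a1 /a2; field; rewrite sN0 !gt_eqF.
have e2 : (a1 * dB - b1 * dK) / (a2 * dB - b2 * dK) = t / c.
  by rewrite v1 v2 -mulf_div divff ?mul1r // gt_eqF.
have atE : atan (t / c) = s * (ph / 2).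
  have tanE : g / c = tan (ph / 2) by [].
  have aE : atan (g / c) = ph / 2 by rewrite tanE tanK // in_itv /= hN.
  rewrite /t -mulrA.
  have [->|->] : s = 1 \/ s = -1.
    by move/eqP: s2; rewrite sqrf_eq1 => /orP[/eqP|/eqP]; [left|right].
    by rewrite !mul1r.
  by rewrite !mulN1r atanN aE.
have hm : exists2 m : R, 0 < m & forall p, in_sector s dK dB p ->
    m * (p.1 ^+ 2 + p.2 ^+ 2) <= qform K B p.
  by have [m m0 hm] := qform_lower_def disc; exists m.
have := @sector_time_ratio R s K B dK dB a1 b1 a2 b2
  (fun x => om^-1 * atan x) (fun x => om^-1 * (1 + x ^+ 2)^-1) (fun=> True) s2 dK0.
rewrite e1 e2 v2 => H.
have {}H : sector_time s K B dK dB (s * (om^-1 * atan (t / c) - om^-1 * atan (- (t / c))))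
  (fun p => om^-1 * atan ((a1 * p.1 + b1 * p.2) / (a2 * p.1 + b2 * p.2)) -
    om^-1 * atan (- (t / c))).
  apply: H => //.
  - rewrite [ltRHS](_ : _ = s ^+ 2 * (K * c)); last by rewrite /a2; ring.
    by rewrite s2 mul1r mulr_gt0.
  - exact: mulr_gt0.
  - by move=> x y _ _ xy; rewrite ler_pM2l ?invr_gt0 // le_atan.
  - move=> p l20 _; set l1 := a1 * p.1 + b1 * p.2; set l2 := a2 * p.1 + b2 * p.2 in l20 *.
    have sumE : l1 ^+ 2 + l2 ^+ 2 = K * qform K B p.
      rewrite (_ : _ + _ = s ^+ 2 * ((c ^+ 2 + t ^+ 2) *
        ((K * p.1 + B / 2 * p.2) ^+ 2 + om ^+ 2 * p.2 ^+ 2))).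
        by rewrite s2 ct om2 /qform; field.
      by rewrite /l1 /l2 /a1 /a2 /b1 /b2; field.
    have detE : a1 * b2 - b1 * a2 = K * om.
      rewrite (_ : _ - _ = s ^+ 2 * (c ^+ 2 + t ^+ 2) * (K * om)).
        by rewrite s2 ct !mul1r.
      by rewrite /a1 /a2 /b1 /b2; field.
    by rewrite detE; exact: atan_slope.
have TE : s * (om^-1 * atan (t / c) - om^-1 * atan (- (t / c))) = ph / om.
  rewrite atanN atE (_ : _ * _ = s ^+ 2 * (ph / om)); first by rewrite s2 mul1r.
  by field.
rewrite TE in H.
exists (ph / om); eexists; split; first exact: H.
  exact: divr_gt0.
have L2 : 0 < dK ^+ 2 + dB ^+ 2.
  by rewrite ltr_pwDl ?sqr_ge0 // exprn_even_gt0 //= lt_eqF.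
rewrite /Lambda disc -/s -/om -/Q -/ph.
set L := Num.sqrt _.
have L0 : 0 < L by rewrite sqrtr_gt0.
have LL : dK ^+ 2 + dB ^+ 2 = L ^+ 2 by rewrite sqr_sqrtr // ltW.
have DE : K * qform_line K B dK dB = om ^+ 2 * dK ^+ 2 + Q ^+ 2 / 4.
  by rewrite om2 QE /qform_line; field.
have D0 : 0 < qform_line K B dK dB.
  rewrite -(pmulr_rgt0 _ K0) DE ltr_pwDl ?divr_ge0 ?sqr_ge0 //.
  by rewrite mulr_gt0 // exprn_even_gt0 //= lt_eqF.
have XE : dK ^+ 2 / L ^+ 2 + Q ^+ 2 / (4 * om ^+ 2 * L ^+ 2) =
    K * qform_line K B dK dB / (om * L) ^+ 2.
  by rewrite DE; field; rewrite omn gt_eqF.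
have X0 := mulr_gt0 K0 D0.
have oL := mulr_gt0 om0 L0.
have oL2 : 0 < (om * L) ^+ 2 by rewrite exprn_gt0.
have Ko : 0 < K / om by rewrite divr_gt0.
have KL : 0 < K * L ^+ 2 by rewrite mulr_gt0 // exprn_gt0.
rewrite XE /powR (gt_eqF (divr_gt0 X0 oL2)) (gt_eqF (mulr_gt0 Ko (expR_gt0 _))).
rewrite -expRD; congr expR.
rewrite lnM ?posrE ?expR_gt0 // expRK !ln_div ?posrE // lnXn // lnM ?posrE // lnM ?posrE //.
rewrite /log_ratio LL ln_div ?posrE // lnM ?posrE ?exprn_gt0 // lnXn // !mulr2n.
by field.
Qed.

End sector_underdamped.

(** * The rotating case *)

Section sector_piece.
Context {R : realType}.
Variables (s K B dK dB T c k : R) (tau : R * R -> R).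
Hypotheses (K_gt0 : 0 < K) (B_gt0 : 0 < B) (c_gt0 : 0 < c).
Hypothesis tauP : sector_time s K B dK dB T tau.
Implicit Types p : R * R.

Definition piece p : R := quad (c * K, c * B, c) p * expR (k * tau p).

Definition piece_grad p : R * R :=
  (c * expR (k * tau p) * (2 * K * p.1 + (B + k) * p.2),
   c * expR (k * tau p) * (2 * p.2 + (B - k) * p.1)).

Lemma quad_qform p : quad (c * K, c * B, c) p = c * qform K B p.
Proof. by rewrite /quad /qform /=; ring. Qed.

Lemma qform_sector_gt0 p : in_sector s dK dB p -> p != 0 -> 0 < qform K B p.
Proof.
move=> Sp p0; have [_ _ [m m0 hm] _ _] := tauP.
by apply: lt_le_trans (hm p Sp); rewrite mulr_gt0 // sumsqr_gt0.
Qed.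

(** The factor [qform K B p] of the piece cancels the denominator in the gradient of [tau], which
    leaves the polynomial factors of [piece_grad]. *)
Lemma has_grad_piece p : in_sector s dK dB p -> p != 0 ->
  has_grad piece p (piece_grad p).
Proof.
move=> Sp p0; have [tg _ _ _ _] := tauP.
have q0 := qform_sector_gt0 Sp p0.
have De : is_derive (tau p) 1 (fun y : R => expR (k * y)) (k * expR (k * tau p)).
  have H : is_derive (tau p) 1 (fun y : R => k * y) k.
    by apply: is_derive_eq; rewrite /= [k *: _]mulr1.
  have := @is_derive1_comp R expR (fun s : R => k * s) (tau p) _ _ (is_derive_expR _) H.
  by rewrite mulrC.
have hg := has_gradM (has_grad_quad (c * K, c * B, c) p) (has_grad_comp (tg p Sp p0) De).
apply: (has_grad_eq hg) => //=; rewrite quad_qform /piece_grad /quad_grad /=.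
  by field; rewrite gt_eqF.
by field; rewrite gt_eqF.
Qed.

Lemma piece_axis p : p != 0 -> p.2 = 0 -> piece p = c * K * p.1 ^+ 2.
Proof.
move=> p0 p2; have [_ _ _ t0 _] := tauP.
by rewrite /piece t0 // mulr0 expR0 mulr1 quad_qform /qform p2; ring.
Qed.

Lemma piece_line p : p != 0 -> dK * p.1 + dB * p.2 = 0 ->
  piece p = c * qform K B p * expR (k * (s * T)).
Proof.
move=> p0 hp; have [_ _ _ _ t1] := tauP.
by rewrite /piece t1 // quad_qform.
Qed.

Lemma piece_decay p :
  (piece_grad p).1 * p.2 + (piece_grad p).2 * (- K * p.1 - B * p.2) =
  - (B - k) * piece p.
Proof. by rewrite /piece_grad /piece quad_qform /qform /=; ring. Qed.

(** As [tau] is bounded on the sector, the exponential factor stays between [E^-1] and [E], and the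
    estimates are those of a quadratic form. *)
Lemma piece_bounds : exists m M : R, [/\ 0 < m, 0 < M,
  forall p, in_sector s dK dB p -> m * (p.1 ^+ 2 + p.2 ^+ 2) <= piece p,
  forall p, in_sector s dK dB p -> piece p <= M * (p.1 ^+ 2 + p.2 ^+ 2) &
  forall p, in_sector s dK dB p -> p != 0 ->
    `|(piece_grad p).1| <= M * (`|p.1| + `|p.2|) /\
    `|(piece_grad p).2| <= M * (`|p.1| + `|p.2|)].
Proof.
have K0 := K_gt0; have B0 := B_gt0; have c0 := c_gt0.
have [_ [T0 hT] [m m0 hm] _ _] := tauP.
pose E := expR (`|k| * T0).
have E0 : 0 < E by exact: expR_gt0.
have EE p : in_sector s dK dB p -> p != 0 -> E^-1 <= expR (k * tau p) <= E.
  move=> Sp p0; rewrite -expRN !ler_expR -ler_norml normrM ler_wpM2l //.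
  exact: hT.
pose S := 2 * K + B + `|k| + 2.
have S0 : 0 < S by rewrite /S; have := normr_ge0 k; lra.
pose N := quad_norm (c * K, c * B, c).
have N0 : 0 <= N := quad_norm_ge0 _.
have n0 p : p = 0 -> piece p = 0 /\ p.1 ^+ 2 + p.2 ^+ 2 = 0.
  by move=> ->; rewrite /piece quad_qform /qform /= !expr0n /= !mulr0 !addr0 mulr0 mul0r.
have s0 p : 0 <= p.1 ^+ 2 + p.2 ^+ 2 by rewrite addr_ge0 ?sqr_ge0.
exists (c * m * E^-1), (N * E + c * E * S); split.
- by rewrite !mulr_gt0 ?invr_gt0.
- by rewrite ltr_wpDl ?mulr_gt0 // mulr_ge0 // ltW.
- move=> p Sp; have [/n0 [-> ->]|p0] := eqVneq p 0; first by rewrite mulr0.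
  have /andP[e1 _] := EE p Sp p0; rewrite /piece quad_qform.
  rewrite [leLHS](_ : _ = c * ((m * (p.1 ^+ 2 + p.2 ^+ 2)) * E^-1)); last by ring.
  rewrite -[leRHS]mulrA ler_pM2l //; apply: ler_pM => //.
  - by apply: mulr_ge0 => //; exact: ltW.
  - by rewrite invr_ge0 ltW.
  - exact: hm.
- move=> p Sp; have [/n0 [-> ->]|p0] := eqVneq p 0; first by rewrite mulr0.
  have /andP[_ e2] := EE p Sp p0.
  have h1 := le_trans (ler_norm _) (quad_le (c * K, c * B, c) p).
  have q0 : 0 <= quad (c * K, c * B, c) p.
    by rewrite quad_qform mulr_ge0 ?(ltW c0) // ltW // qform_sector_gt0.
  have h2 : piece p <= N * (p.1 ^+ 2 + p.2 ^+ 2) * E.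
    by apply: ler_pM => //; exact: expR_ge0.
  apply: (le_trans h2).
  have cES : 0 <= c * E * S by apply: ltW; rewrite !mulr_gt0.
  have := mulr_ge0 cES (s0 p).
  lra.
- move=> p Sp p0; have /andP[_ e2] := EE p Sp p0.
  have a1 := normr_ge0 p.1; have a2 := normr_ge0 p.2.
  have gen x y : `|x| <= S -> `|y| <= S ->
      `|c * expR (k * tau p) * (x * p.1 + y * p.2)| <=
      (N * E + c * E * S) * (`|p.1| + `|p.2|).
    move=> xS yS; rewrite normrM ger0_norm; last by rewrite mulr_ge0 ?expR_ge0 ?ltW.
    have h1 : `|x * p.1 + y * p.2| <= S * (`|p.1| + `|p.2|).
      apply: (le_trans (ler_normD _ _)); rewrite !normrM mulrDr.
      by apply: lerD; apply: ler_wpM2r.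
    have h2 : c * expR (k * tau p) <= c * E by rewrite ler_pM2l.
    apply: (@le_trans _ _ (c * E * (S * (`|p.1| + `|p.2|)))).
      by apply: ler_pM => //; rewrite mulr_ge0 ?expR_ge0 ?ltW.
    rewrite mulrA ler_wpM2r ?addr_ge0 // lerDr mulr_ge0 // ltW //.
  have k0 := normr_ge0 k.
  split; rewrite /piece_grad /=.
    apply: gen; first by rewrite ger0_norm ?mulr_ge0 ?(ltW K0) // /S; lra.
    by apply: (le_trans (ler_normD _ _)); rewrite (gtr0_norm B0) /S; lra.
  rewrite addrC; apply: gen; last by rewrite ger0_norm // /S; lra.
  by apply: (le_trans (ler_normB _ _)); rewrite (gtr0_norm B0) /S; lra.
Qed.

End sector_piece.

Lemma closed_in_sector (R : realType) (s dK dB : R) :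
  closed [set p : R * R | in_sector s dK dB p].
Proof.
rewrite (_ : [set _ | _] = quad (0, s * dK, s * dB) @^-1` [set x | 0 <= x]).
  apply: preimage_closed; last exact: closed_ge.
  by move=> q _; exact: has_grad_cvg (has_grad_quad _ q).
apply/funext => p; rewrite /in_sector /quad /= /preimage /=.
by congr (is_true (0 <= _)); ring.
Qed.

Lemma GUAS_rotating (R : realType) (K1 K2 B1 B2 T1 T2 : R) (tau1 tau2 : R * R -> R)
    (dK := K1 - K2) (dB := B1 - B2) :
  0 < K1 -> 0 < K2 -> 0 < B1 -> 0 < B2 -> dK < 0 -> 0 < T1 -> 0 < T2 ->
  sector_time (-1) K1 B1 dK dB T1 tau1 -> sector_time 1 K2 B2 dK dB T2 tau2 ->
  ln K2 - ln K1 < B1 * T1 + B2 * T2 -> GUAS (Sigma_w K1 K2 B1 B2).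
Proof.
move=> K10 K20 B10 B20 dK0 T10 T20 st1 st2 gain.
have K12 : K1 < K2 by rewrite -subr_lt0.
(* On the axis the factors [K2] and [K1] give both pieces the value [K1 * K2 * p.1 ^+ 2]. On the
   switching line the two quadratic forms agree, [tau1 = - T1] and [tau2 = T2], so gluing amounts to
   [kapE]. This is its solution, positive by [gain]. *)
pose kap := (B1 * T1 + B2 * T2 - (ln K2 - ln K1)) / (T1 + T2).
have kap0 : 0 < kap by apply: divr_gt0; [rewrite subr_gt0|exact: addr_gt0].
have kapE : ln K2 - ln K1 = (B1 - kap) * T1 + (B2 - kap) * T2.
  have : kap * (T1 + T2) = B1 * T1 + B2 * T2 - (ln K2 - ln K1).
    by rewrite /kap divfK // gt_eqF // addr_gt0.
  lra.
pose P1 := piece K1 B1 K2 (B1 - kap) tau1.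
pose P2 := piece K2 B2 K1 (B2 - kap) tau2.
pose q (p : R * R) := p.2 * (dK * p.1 + dB * p.2).
pose V p := if 0 < q p then P2 p else P1 p.
pose D (b : bool) := [set p : R * R | in_sector (if b then 1 else -1) dK dB p].
pose Q (b : bool) := if b then P2 else P1.
pose g (b : bool) := if b then piece_grad K2 B2 K1 (B2 - kap) tau2
                     else piece_grad K1 B1 K2 (B1 - kap) tau1.
have DT p : D true p -> 0 <= q p by rewrite /D /= /in_sector mul1r.
have DF p : D false p -> q p <= 0 by rewrite /D /= /in_sector mulN1r oppr_ge0.
have Dcov p : exists i, D i p.
  have [h|h] := leP 0 (q p); [exists true|exists false];
    rewrite /D /= /in_sector ?mul1r // mulN1r oppr_ge0; exact: ltW.
have q0cases p : q p = 0 -> p.2 = 0 \/ dK * p.1 + dB * p.2 = 0.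
  by rewrite /q => /eqP; rewrite mulf_eq0 => /orP[/eqP|/eqP]; [left|right].
have glue p : q p = 0 -> P1 p = P2 p.
  move=> q0; have [->|p0] := eqVneq p 0.
    by rewrite /P1 /P2 /piece !quad_qform /qform /= !expr0n /= !mulr0 !addr0 !mulr0 !mul0r.
  have [p2|hp] := q0cases p q0.
    by rewrite /P1 /P2 (piece_axis _ _ st1) // (piece_axis _ _ st2) // [K1 * K2]mulrC.
  rewrite /P1 /P2 (piece_line _ _ st1) // (piece_line _ _ st2) //.
  have -> : qform K2 B2 p = qform K1 B1 p.
    have : p.1 * (dK * p.1 + dB * p.2) = 0 by rewrite hp mulr0.
    by rewrite /qform /dK /dB; lra.
  rewrite !mulN1r mul1r -!mulrA [K2 * _]mulrC [K1 * _]mulrC -!mulrA; congr (_ * _).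
  rewrite -[X in _ * X = _](lnK K20) -[X in _ = _ * X](lnK K10) -!expRD; congr expR.
  by move: kapE; lra.
have VQ i p : D i p -> V p = Q i p.
  case: i => [/DT|/DF] h; rewrite /V /Q.
    by move: h; rewrite le_eqVlt => /orP[/eqP h|->] //; rewrite -h ltxx glue.
  by rewrite ltNge h.
have [m1 [M1 [m10 M10 low1 up1 gr1]]] := piece_bounds (B1 - kap) K10 B10 K20 st1.
have [m2 [M2 [m20 M20 low2 up2 gr2]]] := piece_bounds (B2 - kap) K20 B20 K10 st2.
pose m := Num.min m1 m2; pose M := M1 + M2.
have m0 : 0 < m by rewrite lt_min m10.
have M0 : 0 < M by rewrite addr_gt0.
have M1M : M1 <= M by rewrite lerDl ltW.
have M2M : M2 <= M by rewrite lerDr ltW.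
have s0 (p : R * R) : 0 <= p.1 ^+ 2 + p.2 ^+ 2 by rewrite addr_ge0 ?sqr_ge0.
have a0 (p : R * R) : 0 <= `|p.1| + `|p.2| by rewrite addr_ge0.
have V_ge p : m * (p.1 ^+ 2 + p.2 ^+ 2) <= V p.
  have [i Di] := Dcov p; rewrite (VQ i p Di).
  case: i Di => Di; rewrite /Q.
    by apply: le_trans (low2 p Di); rewrite ler_wpM2r // ge_min lexx orbT.
  by apply: le_trans (low1 p Di); rewrite ler_wpM2r // ge_min lexx.
have V_le p : V p <= M * (p.1 ^+ 2 + p.2 ^+ 2).
  have [i Di] := Dcov p; rewrite (VQ i p Di).
  case: i Di => Di; rewrite /Q.
    by apply: (le_trans (up2 p Di)); rewrite ler_wpM2r.
  by apply: (le_trans (up1 p Di)); rewrite ler_wpM2r.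
have V0 p : 0 <= V p by apply: le_trans (V_ge p); rewrite mulr_ge0 // ltW.
(* The axis lies in the closure of [S_2] but carries the field of [A_1], along which [P2] decays
   there only at the rate [kap * (K1 / K2)]. *)
pose kap' := kap * (K1 / K2).
have kap'0 : 0 < kap' by rewrite mulr_gt0 // divr_gt0.
have kap'le : kap' <= kap.
  by rewrite ler_piMr ?(ltW kap0) // ler_pdivrMr // mul1r ltW.
apply: (@GUAS_energy R _ m M kap') => // t0 z Sz t tt.
apply: (le_trans (V_ge (pt (z t)))).
apply: (@le_trans _ _ (expR (- kap' * (t - t0)) * V (pt (z t0)))); last first.
  by rewrite ler_wpM2l ?expR_ge0 //; exact: V_le.
apply: (@lyapunov_decay R K1 K2 B1 B2 t0 M kap' setT bool D Q g V z) => //.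
- exact: ltW.
- by move=> i; exact: closed_in_sector.
- by move=> i p _; exact: VQ.
- by move=> p _; rewrite ger0_norm.
move=> i p _ Di p0.
have VE := VQ i p Di.
have weaken : - kap * V p <= - kap' * V p by rewrite !mulNr lerN2 ler_wpM2r.
case: i Di VE => Di VE; rewrite /Q /g in VE *; last first.
  have [g1 g2] := gr1 p Di p0; split.
  - exact: has_grad_piece st1 _ Di p0.
  - by apply: (le_trans g1); rewrite ler_wpM2r.
  - by apply: (le_trans g2); rewrite ler_wpM2r.
  have := DF p Di; rewrite /vfield /= -/dK -/dB -/(q p) => ->.
  by rewrite piece_decay -/P1 -VE subKr.
have [g1 g2] := gr2 p Di p0; split.
- exact: has_grad_piece st2 _ Di p0.
- by apply: (le_trans g1); rewrite ler_wpM2r.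
- by apply: (le_trans g2); rewrite ler_wpM2r.
have main : (vfield K1 K2 B1 B2 p).2 = - K2 * p.1 - B2 * p.2 ->
  (piece_grad K2 B2 K1 (B2 - kap) tau2 p).1 * (vfield K1 K2 B1 B2 p).1 +
  (piece_grad K2 B2 K1 (B2 - kap) tau2 p).2 * (vfield K1 K2 B1 B2 p).2 <= - kap' * V p.
  by move=> ->; rewrite [(vfield _ _ _ _ _).1]/= piece_decay -/P2 -VE subKr.
have := DT p Di; rewrite le_eqVlt => /orP[/eqP/esym qp|qp]; last first.
  by apply: main; rewrite /vfield /= -/dK -/dB -/(q p) leNgt qp.
have [p2|hp] := q0cases p qp; last first.
  apply: main; rewrite /vfield /= -/dK -/dB -/(q p) qp lexx.
  by move: hp; rewrite /dK /dB; lra.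
rewrite vfield_axis // VE /P2 (piece_axis _ _ st2) // [(vfield _ _ _ _ _).1]/= p2.
have [_ _ _ t0' _] := st2.
rewrite /piece_grad /= t0' // (mulr0 (B2 - kap)) expR0 p2.
rewrite le_eqVlt; apply/orP; left; apply/eqP; rewrite /kap'; field.
by rewrite gt_eqF.
Qed.

(** * Visible eigenvectors *)

(** A root [l] is negative and the switching form at the eigenvector [(1, l)] is
    [l * (dK + l * dB)], so the hypothesis says that no eigenvector lies in the closed sector. *)
Lemma sector_time_exists (R : realType) (i : nat) (K B dK dB : R) (s := (-1) ^+ i : R) :
  0 < K -> 0 < B -> dK < 0 ->
  (forall l, l ^+ 2 + B * l + K = 0 -> 0 < s * (dK + l * dB)) ->
  exists T tau, [/\ sector_time s K B dK dB T tau, 0 < T &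
    Lambda i K B dK dB = expR (log_ratio s K B dK dB T)].
Proof.
move=> K0 B0 dK0 hl; have [disc|disc|disc] := ltrgtP (B ^+ 2) (4 * K).
- exact: sector_underdamped.
- have r2 : Num.sqrt (B ^+ 2 - 4 * K) ^+ 2 = B ^+ 2 - 4 * K.
    by rewrite sqr_sqrtr // subr_ge0 ltW.
  have rootE (e : R) : e ^+ 2 = 1 ->
      ((- B + e * Num.sqrt (B ^+ 2 - 4 * K)) / 2) ^+ 2 +
      B * ((- B + e * Num.sqrt (B ^+ 2 - 4 * K)) / 2) + K = 0.
    move=> e2; set r := Num.sqrt _ in r2 *.
    rewrite (_ : _ + K = e ^+ 2 * r ^+ 2 / 4 - (B ^+ 2 - 4 * K) / 4); last by field.
    by rewrite e2 r2; field.
  apply: sector_overdamped => //; apply: hl.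
    by rewrite /lambda_a -[- Num.sqrt _]mulN1r; apply: rootE; rewrite sqrrN expr1n.
  by rewrite /lambda_b -[Num.sqrt _]mul1r; apply: rootE; rewrite expr1n.
- apply: sector_critical => //.
  have -> : 2 * dK - B * dB = 2 * (dK + - (B / 2) * dB) by field.
  rewrite mulrCA mulr_gt0 //; apply: hl.
  have -> : K = B ^+ 2 / 4 by rewrite disc; field.
  by field.
Qed.

Section vectors.
Context {R : realType}.
Implicit Types (v : 'cV[R]_2) (K B dK dB : R).

Definition mkv (a b : R) : 'cV[R]_2 := \col_(i < 2) (if i == 0 then a else b).

Lemma z1_mkv a b : z1 (mkv a b) = a. Proof. by rewrite /z1 !mxE. Qed.

Lemma z2_mkv a b : z2 (mkv a b) = b. Proof. by rewrite /z2 !mxE. Qed.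

Lemma cV2P (u v : 'cV[R]_2) : z1 u = z1 v -> z2 u = z2 v -> u = v.
Proof.
move=> h1 h2; apply/matrixP => i j; rewrite (ord1 j).
have [->|->] : i = 0 \/ i = 1.
  by case: i => -[|[|//]] hi; [left|right]; apply/val_inj.
  exact: h1.
exact: h2.
Qed.

Lemma eigenvector_Amx K B l v : eigenvector (Amx K B) l v <->
  [/\ z1 v != 0, z2 v = l * z1 v & l ^+ 2 + B * l + K = 0].
Proof.
have [e1 e2] := Amx_mul K B v.
have c1 : z1 (l *: v) = l * z1 v by rewrite /z1 !mxE.
have c2 : z2 (l *: v) = l * z2 v by rewrite /z2 !mxE.
split.
  move=> [v0 Av]; rewrite Av c1 in e1; rewrite Av c2 in e2.
  have z10 : z1 v != 0.
    apply: contra_neq v0 => z0; apply: cV2P; rewrite ?z0 -?e1 ?z0 ?mulr0 /z1 /z2 ?mxE //.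
  split => //; apply: (mulIf z10); rewrite mul0r.
  by move: e2; rewrite -e1 => e2; lra.
move=> [z10 h1 h2]; split.
  by apply: contraNneq z10 => ->; rewrite /z1 mxE.
apply: cV2P; rewrite ?e1 ?e2 ?c1 ?c2 ?h1 //.
have : (l ^+ 2 + B * l + K) * z1 v = 0 by rewrite h2 mul0r.
lra.
Qed.

Lemma eigenvector_mkv K B l : l ^+ 2 + B * l + K = 0 ->
  eigenvector (Amx K B) l (mkv 1 l).
Proof.
by move=> h; apply/eigenvector_Amx; rewrite z1_mkv z2_mkv mulr1 oner_neq0.
Qed.

Lemma eigenvalue_lt0 K B l : 0 < K -> 0 < B -> l ^+ 2 + B * l + K = 0 -> l < 0.
Proof.
move=> K0 B0 h; rewrite ltNge; apply/negP => l0.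
have := mulr_ge0 (ltW B0) l0; have := sqr_ge0 l; lra.
Qed.

Definition switch dK dB v : R := z2 v * (dK * z1 v + dB * z2 v).

Lemma switch_continuous dK dB : continuous (switch dK dB).
Proof.
move=> v.
have c1 : z1 u @[u --> v] --> z1 v by exact: (@coord_continuous R 2 1 0 0 v).
have c2 : z2 u @[u --> v] --> z2 v by exact: (@coord_continuous R 2 1 1 0 v).
exact: cvgM c2 (cvgD (cvgM (cvg_cst dK) c1) (cvgM (cvg_cst dB) c2)).
Qed.

Lemma switch_eigen K B l v dK dB : eigenvector (Amx K B) l v ->
  switch dK dB v = l * (dK + l * dB) * z1 v ^+ 2.
Proof. by move=> /eigenvector_Amx [_ h _]; rewrite /switch h; ring. Qed.

Lemma switch_eigen_sign K B l v dK dB : 0 < K -> 0 < B ->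
  eigenvector (Amx K B) l v ->
  (switch dK dB v < 0) = (0 < dK + l * dB) /\
  (0 < switch dK dB v) = (dK + l * dB < 0).
Proof.
move=> K0 B0 ev; have [z10 _ h] := (eigenvector_Amx _ _ _ _).1 ev.
have l0 := eigenvalue_lt0 K0 B0 h.
have z2 : 0 < z1 v ^+ 2 by rewrite exprn_even_gt0.
by rewrite (switch_eigen _ _ ev) pmulr_llt0 // pmulr_lgt0 // nmulr_rlt0 // nmulr_rgt0.
Qed.

Lemma nbhs_switch_lt0 dK dB v : switch dK dB v < 0 ->
  nbhs v [set u | switch dK dB u < 0].
Proof.
move=> h; apply: (@switch_continuous dK dB v [set x | x < 0]).
exact: lt_nbhsl.
Qed.

Lemma nbhs_switch_gt0 dK dB v : 0 < switch dK dB v ->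
  nbhs v [set u | 0 < switch dK dB u].
Proof.
move=> h; apply: (@switch_continuous dK dB v [set x | 0 < x]).
exact: lt_nbhsr.
Qed.

(** Along a horizontal line [switch] is affine with slope [dK * z2 v], which is nonzero, so a zero
    at [v] would come with positive values nearby. *)
Lemma interior_switch dK dB v : dK < 0 -> z2 v != 0 ->
  nbhs v [set u | switch dK dB u <= 0] -> switch dK dB v < 0.
Proof.
move=> dK0 z20 hn; rewrite lt_neqAle (nbhs_singleton hn) andbT.
apply/eqP => q0.
have cF : (fun t : R => v + mkv t 0) @ (0 : R) --> v.
  have -> : (fun t : R => v + mkv t 0) = (fun t : R => v + t *: mkv 1 0).
    apply/funext => t; congr (_ + _); apply: cV2P.
      by rewrite z1_mkv {1}/z1 mxE -/(z1 _) z1_mkv mulr1.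
    by rewrite z2_mkv {1}/z2 mxE -/(z2 _) z2_mkv mulr0.
  have c : t *: mkv 1 0 @[t --> (0 : R)] --> (0 : R) *: mkv 1 0.
    by apply: cvgZr_tmp; exact: cvg_id.
  by have := cvgD (cvg_cst v) c; rewrite scale0r addr0; exact.
have [d /= d0 Hd] := cF _ hn.
(* The sign of [t] makes [dK * (t * z2 v)] positive. *)
pose t := - (d / 2) * Num.sg (z2 v).
have td : ball (0 : R) d t.
  rewrite /ball /= sub0r normrN /t normrM normrN normr_sg z20 mulr1 gtr0_norm; lra.
have := Hd _ td; rewrite /= /switch.
have -> : z1 (v + mkv t 0) = z1 v + t by rewrite -[in RHS](z1_mkv t 0) /z1 !mxE.
have -> : z2 (v + mkv t 0) = z2 v by rewrite -[in RHS](addr0 (z2 v)) -[in RHS](z2_mkv t 0) /z2 !mxE.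
rewrite (_ : _ * _ = switch dK dB v + dK * (t * z2 v)); last by rewrite /switch; ring.
rewrite q0 add0r nmulr_rle0 // /t -mulrA -normrEsg.
have := mulr_gt0 (divr_gt0 d0 (ltr0Sn R 1)); rewrite -normr_gt0 in z20.
by move=> /(_ _ z20); lra.
Qed.

End vectors.

Lemma quadratic_root_discr (R : realType) (K B l : R) : l ^+ 2 + B * l + K = 0 ->
  4 * K <= B ^+ 2 /\ `|2 * l + B| = Num.sqrt (B ^+ 2 - 4 * K).
Proof.
move=> h; have e : (2 * l + B) ^+ 2 = B ^+ 2 - 4 * K by lra.
by split; [have := sqr_ge0 (2 * l + B); lra|rewrite -e sqrtr_sqr].
Qed.

(** The bound [2 * K1 / (B1 - r)] is [(B1 + r) / 2], the opposite of the smaller eigenvalue. A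
    positive [dK + l * dB] forces [dB < 0], and then the smaller eigenvalue is the most favourable
    one. *)
Lemma condition_a_eigen (R : realType) (K1 K2 B1 B2 : R) :
  0 < K1 -> 0 < B1 -> K1 - K2 < 0 ->
  condition_a K1 K2 B1 B2 <->
  exists2 l, l ^+ 2 + B1 * l + K1 = 0 & 0 < (K1 - K2) + l * (B1 - B2).
Proof.
move=> K10 B10 dK0; rewrite /condition_a; set dK := K1 - K2 in dK0 *; set dB := B1 - B2.
set r := Num.sqrt _.
have rE : 4 * K1 <= B1 ^+ 2 ->
    2 * K1 / (B1 - r) = (B1 + r) / 2 /\ r ^+ 2 = B1 ^+ 2 - 4 * K1.
  move=> disc; have r2 : r ^+ 2 = B1 ^+ 2 - 4 * K1 by rewrite sqr_sqrtr // subr_ge0.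
  split => //; have : B1 - r != 0.
    rewrite subr_eq0; apply/eqP => e; move: r2; rewrite -e; lra.
  move=> n0; apply: (mulIf n0); rewrite divfK //.
  rewrite (_ : (B1 + r) / 2 * (B1 - r) = (B1 ^+ 2 - r ^+ 2) / 2); last by field.
  by rewrite r2; field.
split.
  move=> [dB0 disc]; have [-> r2] := rE disc.
  rewrite ltr_ndivrMr // => h; exists (- (B1 + r) / 2); last by lra.
  rewrite (_ : _ + _ = (r ^+ 2 - (B1 ^+ 2 - 4 * K1)) / 4); last by field.
  by rewrite r2 subrr mul0r.
move=> [l lE hl]; have [disc lr] := quadratic_root_discr lE.
have l0 := eigenvalue_lt0 K10 B10 lE.
have dB0 : dB < 0 by rewrite -(nmulr_rgt0 _ l0); lra.
split => //; have [-> _] := rE disc; rewrite ltr_ndivrMr //.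
rewrite -/r in lr.
have : - l <= (B1 + r) / 2.
  by have := ler_norm (- (2 * l + B1)); rewrite normrN lr; lra.
by move=> /(ler_wnM2r (ltW dB0)); lra.
Qed.

(** Here the decisive eigenvalue is the larger one, [- (B2 - r) / 2]. When [dB] is nonnegative,
    every real eigenvalue qualifies, both terms of [dK + l * dB] being nonpositive and the first
    negative. *)
Lemma condition_b_eigen (R : realType) (K1 K2 B1 B2 : R) :
  0 < K2 -> 0 < B2 -> K1 - K2 < 0 ->
  condition_b K1 K2 B1 B2 <->
  exists2 l, l ^+ 2 + B2 * l + K2 = 0 & (K1 - K2) + l * (B1 - B2) < 0.
Proof.
move=> K20 B20 dK0; rewrite /condition_b; set dK := K1 - K2 in dK0 *; set dB := B1 - B2.
set r := Num.sqrt _.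
have r0 : 0 <= r by exact: sqrtr_ge0.
have rE : 4 * K2 <= B2 ^+ 2 ->
    2 * K2 / (B2 + r) = (B2 - r) / 2 /\ r ^+ 2 = B2 ^+ 2 - 4 * K2.
  move=> disc; have r2 : r ^+ 2 = B2 ^+ 2 - 4 * K2 by rewrite sqr_sqrtr // subr_ge0.
  have n0 : B2 + r != 0 by rewrite gt_eqF // ltr_pwDl.
  split => //; apply: (mulIf n0); rewrite divfK //.
  rewrite (_ : (B2 - r) / 2 * (B2 + r) = (B2 ^+ 2 - r ^+ 2) / 2); last by field.
  by rewrite r2; field.
split.
  move=> [disc]; have [-> r2] := rE disc; move=> h.
  have lE : (- (B2 - r) / 2) ^+ 2 + B2 * (- (B2 - r) / 2) + K2 = 0.
    rewrite (_ : _ + _ = (r ^+ 2 - (B2 ^+ 2 - 4 * K2)) / 4); last by field.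
    by rewrite r2 subrr mul0r.
  have l0 := eigenvalue_lt0 K20 B20 lE.
  exists (- (B2 - r) / 2) => //.
  case: h => [[dB0]|dB0]; first by rewrite ltr_ndivlMr //; lra.
  by have := mulr_le0_ge0 (ltW l0) dB0; lra.
move=> [l lE hl]; have [disc lr] := quadratic_root_discr lE.
split => //; have [-> _] := rE disc; rewrite -/r in lr.
have [dB0|dB0] := ltP dB 0; [left; split => //|by right].
rewrite ltr_ndivlMr //.
have : (B2 - r) / 2 <= - l by have := ler_norm (2 * l + B2); rewrite lr; lra.
by move=> /(ler_wnM2r (ltW dB0)); lra.
Qed.

(** At [l] the two characteristic polynomials differ by [dK + l * dB], whose sign is opposite to
    that of the switching form. Membership in a closure gives its weak sign, which is what the
    inequalities on the slope require. *)
Lemma visible_invariant_slope (R : realType) (K1 K2 B1 B2 l : R) (v : 'cV[R]_2) :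
  0 < K1 -> 0 < K2 -> 0 < B1 -> 0 < B2 ->
  visible K1 K2 B1 B2 l v -> invariant_slope K1 K2 B1 B2 (- l).
Proof.
move=> K10 K20 B10 B20 [] [ev cl].
  have [_ _ lE] := (eigenvector_Amx _ _ _ _).1 ev.
  have [_ sg] := switch_eigen_sign (K1 - K2) (B1 - B2) K10 B10 ev.
  have l0 := eigenvalue_lt0 K10 B10 lE.
  have : ~ (0 < switch (K1 - K2) (B1 - B2) v).
    move=> /nbhs_switch_gt0 /cl [u [/=]]; rewrite /S1 /switch /= => h1 h2.
    by rewrite ltNge h1 in h2.
  rewrite sg => /negP; rewrite -leNgt => h.
  by split; rewrite ?oppr_gt0 ?sqrrN //; [lra|lra|left; lra].
have [_ _ lE] := (eigenvector_Amx _ _ _ _).1 ev.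
have [sg _] := switch_eigen_sign (K1 - K2) (B1 - B2) K20 B20 ev.
have l0 := eigenvalue_lt0 K20 B20 lE.
have : ~ (switch (K1 - K2) (B1 - B2) v < 0).
  move=> /nbhs_switch_lt0 /cl [u [/=]]; rewrite /S2 /switch /= => h1 h2.
  by rewrite ltNge (ltW h1) in h2.
rewrite sg => /negP; rewrite -leNgt => h.
by split; rewrite ?oppr_gt0 ?sqrrN //; [lra|lra|right; lra].
Qed.

Lemma GUAS_no_visible (R : realType) (K1 K2 B1 B2 : R) :
  0 < K1 -> 0 < K2 -> 0 < B1 -> 0 < B2 -> K1 - K2 < 0 ->
  ~ (exists (lambda : R) (v : 'cV[R]_2), visible K1 K2 B1 B2 lambda v) ->
  Lambda 1 K1 B1 (K1 - K2) (B1 - B2) * Lambda 2 K2 B2 (K1 - K2) (B1 - B2) < 1 ->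
  GUAS (Sigma_w K1 K2 B1 B2).
Proof.
move=> K10 K20 B10 B20; set dK := K1 - K2; set dB := B1 - B2 => dK0 nv.
have no1 l : l ^+ 2 + B1 * l + K1 = 0 -> dK + l * dB < 0.
  move=> lE; have ev := eigenvector_mkv lE.
  have [_ <-] := switch_eigen_sign dK dB K10 B10 ev.
  rewrite ltNge; apply/negP => h; apply: nv; exists l, (mkv 1 l); left; split => //.
  by apply: subset_closure; exact: h.
have no2 l : l ^+ 2 + B2 * l + K2 = 0 -> 0 < dK + l * dB.
  move=> lE; have ev := eigenvector_mkv lE.
  have [sg1 sg2] := switch_eigen_sign dK dB K20 B20 ev.
  rewrite ltNge le_eqVlt; apply/negP => /orP[/eqP h|h].
    (* If [dK + l * dB = 0], then [l] is also an eigenvalue of [A_1], which [no1] excludes. *)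
    have : dK + l * dB < 0 by apply: no1; move: h; rewrite /dK /dB; lra.
    by rewrite h ltxx.
  rewrite -sg2 in h; apply: nv; exists l, (mkv 1 l); right; split => //.
  by apply: subset_closure; exact: h.
have [|T1 [tau1 [st1 T10 L1]]] := @sector_time_exists R 1 K1 B1 dK dB K10 B10 dK0.
  by move=> l /no1; rewrite expr1 mulN1r oppr_gt0.
have [|T2 [tau2 [st2 T20 L2]]] := @sector_time_exists R 2 K2 B2 dK dB K20 B20 dK0.
  by move=> l /no2; rewrite sqrrN expr1n mul1r.
rewrite L1 L2 -expRD expR_lt1 {L1 L2}.
rewrite expr1 in st1 *; rewrite sqrrN expr1n in st2 *.
rewrite /log_ratio.
(* The sectors share the switching line and have opposite signs [s]: the terms in [qform_line] and
   [dK ^+ 2 + dB ^+ 2] cancel, leaving [(ln K2 - ln K1 - B1 * T1 - B2 * T2) / 2]. *)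
have De : qform_line K1 B1 dK dB = qform_line K2 B2 dK dB.
  by rewrite /qform_line /dK /dB; ring.
have L20 : 0 < dK ^+ 2 + dB ^+ 2.
  by rewrite ltr_pwDl ?sqr_ge0 // exprn_even_gt0 //= lt_eqF.
have D0 : 0 < qform_line K2 B2 dK dB.
  have vn : ((dB, - dK) : R * R) != 0 by rewrite pair_neq0 /= oppr_eq0 (lt_eqF dK0) orbT.
  have vs : in_sector 1 dK dB (dB, - dK).
    by rewrite /in_sector /= (_ : _ + _ = 0) ?mulr0 //; ring.
  have := qform_sector_gt0 st2 vs vn.
  by congr (0 < _); rewrite /qform /qform_line /=; ring.
rewrite De !ln_div ?posrE ?mulr_gt0 // !lnM ?posrE // => h.
apply: (GUAS_rotating K10 K20 B10 B20 dK0 T10 T20 st1 st2).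
lra.
Qed.

Unset Implicit Arguments.

(** The strict inequality in [condition_a] corresponds to an eigenvector off the switching line,
    whence the interior of [S1], while [S2] is already open. An eigenvector of [A_1] on the
    switching line is covered by the alternative on visible eigenvectors. *)
Theorem theorem1 (R : realType) (K1 K2 B1 B2 : R)
    (K1_gt0 : 0 < K1) (K2_gt0 : 0 < K2) (B1_gt0 : 0 < B1) (B2_gt0 : 0 < B2)
    (dK_lt0 : K1 - K2 < 0) :
  [/\ condition_a K1 K2 B1 B2 <->
        (exists (lambda : R) (v : 'cV[R]_2), [/\ lambda < 0, eigenvector (Amx K1 B1) lambda v &
           interior (S1 K1 K2 B1 B2) v]),
      condition_b K1 K2 B1 B2 <->
        (exists (lambda : R) (v : 'cV[R]_2), [/\ lambda < 0, eigenvector (Amx K2 B2) lambda v &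
           S2 K1 K2 B1 B2 v]) &
      [\/ (exists (lambda : R) (v : 'cV[R]_2), lambda < 0 /\ visible K1 K2 B1 B2 lambda v),
          condition_a K1 K2 B1 B2 \/ condition_b K1 K2 B1 B2 |
          ~ (exists (lambda : R) (v : 'cV[R]_2), visible K1 K2 B1 B2 lambda v) /\
          Lambda 1 K1 B1 (K1 - K2) (B1 - B2) *
          Lambda 2 K2 B2 (K1 - K2) (B1 - B2) < 1] ->
      GUAS (Sigma_w K1 K2 B1 B2)].
Proof.
have iffa : condition_a K1 K2 B1 B2 <->
    exists (lambda : R) (v : 'cV[R]_2), [/\ lambda < 0, eigenvector (Amx K1 B1) lambda v &
           interior (S1 K1 K2 B1 B2) v].
  apply: (iff_trans (condition_a_eigen _ K1_gt0 B1_gt0 dK_lt0)); split.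
    move=> [l lE hl]; have ev := eigenvector_mkv lE.
    exists l, (mkv 1 l); split => //; first exact: eigenvalue_lt0 lE.
    have [sg _] := switch_eigen_sign (K1 - K2) (B1 - B2) K1_gt0 B1_gt0 ev.
    rewrite -sg in hl; apply: filterS (nbhs_switch_lt0 hl) => u /= hu.
    exact: ltW.
  move=> [l [v [l0 ev iv]]].
  have [z10 z2E lE] := (eigenvector_Amx _ _ _ _).1 ev.
  exists l => //.
  have [<- _] := switch_eigen_sign (K1 - K2) (B1 - B2) K1_gt0 B1_gt0 ev.
  by apply: interior_switch => //; rewrite z2E mulf_neq0 // lt_eqF.
have iffb : condition_b K1 K2 B1 B2 <->
    exists (lambda : R) (v : 'cV[R]_2), [/\ lambda < 0, eigenvector (Amx K2 B2) lambda v &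
           S2 K1 K2 B1 B2 v].
  apply: (iff_trans (condition_b_eigen _ K2_gt0 B2_gt0 dK_lt0)); split.
    move=> [l lE hl]; have ev := eigenvector_mkv lE.
    exists l, (mkv 1 l); split => //; first exact: eigenvalue_lt0 lE.
    have [_ sg] := switch_eigen_sign (K1 - K2) (B1 - B2) K2_gt0 B2_gt0 ev.
    by rewrite -sg in hl.
  move=> [l [v [l0 ev iv]]].
  have [_ _ lE] := (eigenvector_Amx _ _ _ _).1 ev.
  exists l => //.
  by have [_ <-] := switch_eigen_sign (K1 - K2) (B1 - B2) K2_gt0 B2_gt0 ev.
have vis l v : visible K1 K2 B1 B2 l v -> GUAS (Sigma_w K1 K2 B1 B2).
  move=> /(visible_invariant_slope K1_gt0 K2_gt0 B1_gt0 B2_gt0) slope.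
  by apply: (GUAS_invariant_slope K1_gt0 _ B1_gt0 B2_gt0 slope); rewrite -subr_lt0.
split => // -[[l [v [_ /vis]]]//|[/iffa|/iffb] [l [v [_ ev hv]]]|[nv hL]].
- apply: (vis l v); left; split; first exact: ev.
  by apply: subset_closure; exact: interior_subset hv.
- apply: (vis l v); right; split; first exact: ev.
  exact: subset_closure.
- exact: GUAS_no_visible.
Qed.
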